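(* In the sense of analytic continuation in the parameter $\phi$, $$\int_{0}^{\infty}\left(3-2\sqrt2\cos(v\ln 2)\right)\operatorname{Im}\!\left(\zeta\!\left(\tfrac12+iv\right)\right)\tanh(\pi v)\,dv=3\ln 2-2;$$ that is, $$\lim_{\phi\to\pi^{-}}\int_{0}^{\infty}\left(3-2\sqrt2\cos(v\ln 2)\right)\operatorname{Im}\!\left(\zeta\!\left(\tfrac12+iv\right)\right)\frac{\sinh(\phi v)}{\cosh(\pi v)}\,dv=3\ln 2-2.$$
   Context: $\zeta$ is the Riemann zeta function. The integral with $\tanh(\pi v)$ is not claimed to converge; it is assigned the value, continued to $\phi=\pi$, of the integral with $\tanh(\pi v)$ replaced by $\sinh(\phi v)/\cosh(\pi v)$, which converges for real $|\phi|<\pi$. *)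

(* Defs.v *)
From Stdlib Require Import Reals.
From Coquelicot Require Import Coquelicot.
Open Scope R_scope.

(* Analyticity over a valued ring K, used below with K = C and with K = R: near
   x, the function f is the sum of a power series centred at x. *)
Definition analytic_at {K : AbsRing} (f : K -> K) (x : K) : Prop :=
  exists a : nat -> K,
    locally x (fun y =>
      @is_pseries K (AbsRing_NormedModule K) a (minus y x) (f y)).

Definition Cexp (z : C) : C :=
  (exp (Re z) * cos (Im z), exp (Re z) * sin (Im z)).

(* The term n^{-s} of the Dirichlet series, for n >= 1. *)
Definition dirichlet_term (s : C) (n : nat) : C :=
  Cexp (- s * RtoC (ln (INR n)))%C.

(* The Riemann zeta function is the analytic continuation to C \ {1} of the
   series sum_{n >= 1} n^{-s}, Re s > 1.  Since C \ {1} is connected, these two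
   clauses determine zeta everywhere except at the pole s = 1, where the value
   of the total function zeta is left arbitrary. *)
Definition is_riemann_zeta (zeta : C -> C) : Prop :=
  (forall s : C, 1 < Re s ->
     is_series (fun n : nat => dirichlet_term s (S n)) (zeta s)) /\
  (forall s : C, s <> RtoC 1 -> @analytic_at C_AbsRing zeta s).

(* g with the damping factor that becomes tanh (PI v) at phi = PI. *)
Definition sinh_cosh_integrand (g : R -> R) (phi v : R) : R :=
  g v * (sinh (phi * v) / cosh (PI * v)).

(* "int_0^oo g(v) tanh(PI v) dv = L" in the sense of analytic continuation in
   phi: the improper integrals with sinh (phi v) / cosh (PI v) converge for
   |phi| < PI, and their value F phi extends analytically to phi = PI, with
   F PI = L. *)
Definition is_continued_tanh_integral (g : R -> R) (L : R) : Prop :=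
  exists F : R -> R,
    (forall phi : R, Rabs phi < PI ->
       is_RInt_gen (sinh_cosh_integrand g phi)
         (at_point 0) (Rbar_locally p_infty) (F phi)) /\
    (forall phi : R, - PI < phi <= PI -> @analytic_at R_AbsRing F phi) /\
    F PI = L.

Definition zeta_weight (zeta : C -> C) (v : R) : R :=
  (3 - 2 * sqrt 2 * cos (v * ln 2)) * Im (zeta (1 / 2, v)).

(* Main.v *)
Require Import Defs.
From Stdlib Require Import Reals.
From Coquelicot Require Import Coquelicot.
From Stdlib Require Import Lra Lia.
Open Scope R_scope.

(** Write [s = 1/2 + i v].  Since
    [3 - 2 sqrt 2 cos (v ln 2) = 3 - 2^s - 2^(1-s)] and multiplication by this
    factor regroups the Dirichlet series, the weight is the imaginary part of
    [sum_k (2 (2k+1)^-s - (2k+1/2)^-s - (2k+3/2)^-s)], which converges for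
    [Re s > 0] and represents [(3 - 2^s - 2^(1-s)) zeta(s)] there by analytic
    continuation along a horizontal line.  The Fourier transform of
    [sinh (p v) / cosh (PI v)], that is, the partial fractions of [1 / cosh],
    turns each [x^-s] into
    [(1 - x) sin (p/2) / (1 + 2 x cos p + x^2)],
    and integral and sum commute by dominated convergence.  Expanding these
    kernels in powers of [x] or [1 / x] gives [sum_j c_j sin ((j + 1/2) p)] with
    geometrically decaying [c_j]: an analytic function of [p] on the whole real
    line, as the kernel with [x = 1], the only one with a pole at [p = PI],
    vanishes.  At [p = PI] a rational series with sum [3 ln 2 - 2] remains. *)

(** * Dominated convergence for series *)

(** The coefficients -1, 2, -1, 0 of the regrouped series add up to zero, in accordance with the
    zero of [3 - 2^s - 2^(1-s)] at [s = 1], which cancels the pole of zeta. Its terms are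
    differences of neighbouring increments of [x^-s], dominated by a telescoping series in [k] at
    the price of a factor linear in [v]. For [|p| < PI] the decay [exp (- (PI - |p|) v)] of the
    damping factor absorbs that factor. This domination is lost as [p] tends to [PI], so the limit
    is never taken under the integral sign: the integral is evaluated for each fixed [p], and only
    its value, a function of [p] alone, is followed up to [PI]. The partial fractions are obtained
    without residues, from a Fourier expansion at the origin summed by arithmetic means. The
    averaged kernel is explicit and of size [1 / t^2]; a function whose deviation from its value at
    0 is quadratic compensates it, and the division by the number of terms produces the limit. *)

Lemma exp_le_compat (x y : R) : x <= y -> exp x <= exp y.
Proof.
  intros [H| ->]; [left; now apply exp_increasing | apply Rle_refl].
Qed.

Lemma filterlim_locally_R {T : Type} (F : (T -> Prop) -> Prop) (FF : Filter F)
  (f : T -> R) (l : R) :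
  filterlim f F (locally l) <->
  (forall eps : R, 0 < eps -> F (fun x => Rabs (f x - l) < eps)).
Proof.
  split.
  - intros H eps He.
    exact (proj1 (filterlim_locally f l) H (mkposreal eps He)).
  - intros H. apply filterlim_locally. intros [eps He]. exact (H eps He).
Qed.

Lemma filterlim_Rabs_le {T : Type} (F : (T -> Prop) -> Prop)
  (FF : ProperFilter F) (f : T -> R) (l M : R) :
  F (fun x => Rabs (f x) <= M) -> filterlim f F (locally l) -> Rabs l <= M.
Proof.
  intros HM Hl. apply Rnot_lt_le. intros Hlt.
  pose proof (proj1 (filterlim_locally_R F _ f l) Hl (Rabs l - M) ltac:(lra)) as H.
  destruct (filter_ex _ (filter_and _ _ HM H)) as [x [H1 H2]].
  pose proof (Rabs_triang (l - f x) (f x)) as H3.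
  replace (l - f x + f x) with l in H3 by ring.
  rewrite Rabs_minus_sym in H3. lra.
Qed.

Lemma filterlim_plus_R {T : Type} (F : (T -> Prop) -> Prop) (FF : Filter F)
  (f g : T -> R) (l m : R) :
  filterlim f F (locally l) -> filterlim g F (locally m) ->
  filterlim (fun x => f x + g x) F (locally (l + m)).
Proof.
  intros Hf Hg.
  exact (filterlim_comp_2 f g Rplus Hf Hg (filterlim_plus (V := R_NormedModule) l m)).
Qed.

Lemma filterlim_scal_R {T : Type} (F : (T -> Prop) -> Prop) (FF : Filter F)
  (c : R) (f : T -> R) (l : R) :
  filterlim f F (locally l) -> filterlim (fun x => c * f x) F (locally (c * l)).
Proof.
  intros Hf.
  exact (filterlim_comp _ _ _ f (fun y => scal c y) F _ _ Hf
           (filterlim_scal_r (V := R_NormedModule) c l)).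
Qed.

Lemma sum_Sn_R (a : nat -> R) (n : nat) : sum_n a (S n) = sum_n a n + a (S n).
Proof. apply (sum_Sn (G := R_AbelianMonoid)). Qed.

Lemma filterlim_sum_n {T : Type} (F : (T -> Prop) -> Prop) (FF : Filter F)
  (g : nat -> T -> R) (l : nat -> R) (n : nat) :
  (forall k, filterlim (g k) F (locally (l k))) ->
  filterlim (fun b => sum_n (fun k => g k b) n) F (locally (sum_n l n)).
Proof.
  intros H. induction n as [|n IH].
  - apply filterlim_ext with (g 0%nat).
    + intros x. now rewrite sum_O.
    + rewrite sum_O. apply H.
  - apply filterlim_ext with (fun b => sum_n (fun k => g k b) n + g (S n) b).
    + intros x. now rewrite sum_Sn.
    + rewrite sum_Sn. apply filterlim_plus_R; auto.
Qed.

Lemma is_series_ext_R (a b : nat -> R) (l : R) :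
  (forall n, a n = b n) -> is_series a l -> is_series b l.
Proof. exact (is_series_ext (V := R_NormedModule) a b l). Qed.

Lemma is_series_scal_R (c : R) (a : nat -> R) (l : R) :
  is_series a l -> is_series (fun n => c * a n) (c * l).
Proof. exact (is_series_scal_l (V := R_NormedModule) c a l). Qed.

Lemma ex_series_scal_R (c : R) (a : nat -> R) :
  ex_series a -> ex_series (fun n => c * a n).
Proof. exact (ex_series_scal_l (V := R_NormedModule) c a). Qed.

Lemma is_series_plus_R (a b : nat -> R) (l m : R) :
  is_series a l -> is_series b m -> is_series (fun n => a n + b n) (l + m).
Proof. exact (is_series_plus (V := R_NormedModule) a b l m). Qed.

Lemma ex_series_dom (a M : nat -> R) :
  ex_series M -> (forall k, Rabs (a k) <= M k) -> ex_series a.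
Proof.
  intros HM H. exact (ex_series_le (V := R_CompleteNormedModule) a M H HM).
Qed.

(** The bound is uniform over all [a] dominated by [M]. This yields Tannery's theorem and, later,
    uniform convergence of the weight on bounded intervals. *)
Lemma Series_tail (a M : nat -> R) (n : nat) :
  ex_series M -> (forall k, Rabs (a k) <= M k) ->
  Rabs (Series a - sum_n a n) <= Series M - sum_n M n.
Proof.
  intros HM H.
  pose proof (ex_series_dom a M HM H) as Ha.
  rewrite (Series_incr_n a (S n) ltac:(lia) Ha).
  rewrite (Series_incr_n M (S n) ltac:(lia) HM).
  rewrite !sum_n_Reals. simpl Init.Nat.pred.
  replace (_ - sum_f_R0 a n) with (Series (fun k => a (S n + k)%nat)) by ring.
  replace (_ - sum_f_R0 M n) with (Series (fun k => M (S n + k)%nat)) by ring.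
  assert (HM' : ex_series (fun k => M (S n + k)%nat)) by now apply ex_series_incr_n.
  eapply Rle_trans.
  - apply Series_Rabs. apply ex_series_dom with (2 := fun k => Req_le _ _ (Rabs_Rabsolu _)).
    apply ex_series_dom with (1 := HM'). intros k. rewrite Rabs_Rabsolu. apply H.
  - apply Series_le; [|exact HM']. intros k. split; [apply Rabs_pos | apply H].
Qed.

Lemma is_series_R (a : nat -> R) (l : R) :
  is_series a l <-> filterlim (fun n => sum_n a n : R) eventually (locally l).
Proof. split; intros H; exact H. Qed.

Lemma Series_tail_small (M : nat -> R) (eps : R) :
  ex_series M -> 0 < eps -> exists n, Series M - sum_n M n < eps.
Proof.
  intros HM He.
  pose proof (proj1 (is_series_R _ _) (Series_correct M HM)) as H.
  pose proof (proj1 (filterlim_locally_R _ _ _ _) H eps He) as [n Hn].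
  exists n. specialize (Hn n (le_n n)). apply Rabs_def2 in Hn. lra.
Qed.

(* Tannery's theorem. *)
Lemma filterlim_Series_dom {T : Type} (F : (T -> Prop) -> Prop)
  (FF : ProperFilter F) (g : nat -> T -> R) (l M : nat -> R) :
  ex_series M -> F (fun b => forall k, Rabs (g k b) <= M k) ->
  (forall k, filterlim (g k) F (locally (l k))) ->
  filterlim (fun b => Series (fun k => g k b)) F (locally (Series l)).
Proof.
  intros HM Hg Hl.
  assert (Hlm : forall k, Rabs (l k) <= M k).
  { intros k. apply (filterlim_Rabs_le F FF (g k)); [|apply Hl].
    revert Hg. apply filter_imp. auto. }
  apply (filterlim_locally_R _ _). intros eps He.
  destruct (Series_tail_small M (eps / 3) HM ltac:(lra)) as [n Hn].
  pose proof (filterlim_sum_n F _ g l n Hl) as Hs.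
  pose proof (proj1 (filterlim_locally_R F _ _ _) Hs (eps / 3) ltac:(lra)) as Hs'.
  generalize (filter_and _ _ Hg Hs'). apply filter_imp. intros b [H1 H2].
  pose proof (Series_tail (fun k => g k b) M n HM H1) as H3.
  pose proof (Series_tail l M n HM Hlm) as H4.
  apply Rabs_def2 in H2. apply Rabs_le_between in H3. apply Rabs_le_between in H4.
  apply Rabs_def1; lra.
Qed.

Lemma sum_n_Series (a : nat -> nat -> R) (K : nat) :
  (forall k, ex_series (fun n => a n k)) ->
  is_series (fun n => sum_n (a n) K) (sum_n (fun k => Series (fun n => a n k)) K).
Proof.
  intros H. induction K as [|K IH].
  - rewrite sum_O. apply is_series_ext with (fun n => a n 0%nat).
    + intros n. now rewrite sum_O.
    + apply Series_correct, H.
  - rewrite sum_Sn.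
    apply is_series_ext with (fun n => plus (sum_n (a n) K) (a n (S K))).
    + intros n. now rewrite sum_Sn.
    + apply (is_series_plus (V := R_NormedModule)); [exact IH | apply Series_correct, H].
Qed.

Lemma sum_n_le_Series (a : nat -> R) (n : nat) :
  (forall k, 0 <= a k) -> ex_series a -> sum_n a n <= Series a.
Proof.
  intros Ha He.
  rewrite (Series_incr_n a (S n) ltac:(lia) He), sum_n_Reals. simpl Init.Nat.pred.
  assert (H : 0 <= Series (fun k => a (S n + k)%nat)); [|lra].
  assert (He' : ex_series (fun k => a (S n + k)%nat)) by now apply ex_series_incr_n.
  rewrite <- (Rmult_0_l (Series (fun k => a (S n + k)%nat))).
  rewrite <- Series_scal_l. apply Series_le; [|exact He'].
  intros k. rewrite Rmult_0_l. split; [lra | apply Ha].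
Qed.

(** The product form of the majorant reduces the exchange to Tannery's theorem: for fixed [n] the
    partial sums over [k] tend to the row sum, and [m n * Series q] dominates them whatever the
    number of terms. *)
Lemma is_series_swap (a : nat -> nat -> R) (m q : nat -> R) :
  ex_series m -> ex_series q -> (forall n k, Rabs (a n k) <= m n * q k) ->
  is_series (fun k => Series (fun n => a n k)) (Series (fun n => Series (a n))).
Proof.
  intros Hm Hq Ha.
  assert (Hcol : forall k, ex_series (fun n => a n k)).
  { intros k. apply ex_series_dom with (fun n => m n * q k).
    - apply ex_series_scal_r; exact Hm.
    - intros n; apply Ha. }
  assert (Hrow : forall n, ex_series (a n)).
  { intros n. apply ex_series_dom with (fun k => m n * q k).
    - apply ex_series_scal_R; exact Hq.
    - intros k; apply Ha. }
  assert (Hmq : forall n k, 0 <= m n * q k).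
  { intros n k. eapply Rle_trans; [apply Rabs_pos | apply Ha]. }
  unfold is_series.
  apply filterlim_ext with (fun K => Series (fun n => sum_n (a n) K)).
  { intros K. apply is_series_unique, sum_n_Series, Hcol. }
  apply (filterlim_Series_dom eventually _ (fun n K => sum_n (a n) K))
    with (M := fun n => m n * Series q).
  - apply ex_series_scal_r; exact Hm.
  - apply filter_forall; intros K n. rewrite <- Series_scal_l.
    eapply Rle_trans; [apply (norm_sum_n_m (a n) 0 K)|].
    eapply Rle_trans; [| apply (sum_n_le_Series (fun k => m n * q k) K)].
    + apply sum_n_m_le; intros k; apply Ha.
    + apply Hmq.
    + apply ex_series_scal_R; exact Hq.
  - intros n; apply Series_correct, Hrow.
Qed.

(** * Real analytic functions *)

Lemma analytic_at_R (f : R -> R) (x : R) :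
  @analytic_at R_AbsRing f x <->
  exists (a : nat -> R) (r : R), 0 < r /\
    forall h, Rabs h < r -> is_series (fun k => a k * h ^ k) (f (x + h)).
Proof.
  split.
  - intros [a [[r Hr] H]]. exists a, r. split; [exact Hr|].
    intros h Hh. apply (proj1 (is_pseries_R _ _ _)).
    replace h with (minus (x + h) x) at 1 by (unfold minus, plus, opp; simpl; ring).
    apply H. change (Rabs (minus (x + h) x) < r).
    replace (minus (x + h) x) with h; [exact Hh|].
    unfold minus, plus, opp; simpl; ring.
  - intros (a & r & Hr & H). exists a, (mkposreal r Hr).
    intros y Hy. change (Rabs (minus y x) < r) in Hy.
    replace (f y) with (f (x + minus y x)) by (f_equal; unfold minus, plus, opp; simpl; ring).
    apply (proj2 (is_pseries_R a (minus y x) _)), H, Hy.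
Qed.

Lemma analytic_at_ext_loc (f g : R -> R) (x r : R) :
  0 < r -> (forall y, Rabs (y - x) < r -> f y = g y) ->
  @analytic_at R_AbsRing f x -> @analytic_at R_AbsRing g x.
Proof.
  intros Hr Hfg Hf. apply analytic_at_R in Hf. destruct Hf as (a & s & Hs & H).
  apply analytic_at_R. exists a, (Rmin r s). split; [now apply Rmin_pos|].
  intros h Hh. rewrite <- Hfg.
  - apply H. eapply Rlt_le_trans; [exact Hh | apply Rmin_r].
  - replace (x + h - x) with h by ring.
    eapply Rlt_le_trans; [exact Hh | apply Rmin_l].
Qed.

(** The midpoint [y] between [|h|] and [r] gives the strict inequality: the series converges there,
    so its terms tend to 0, which is impossible outside the disc of convergence. *)
Lemma CV_radius_gt (a : nat -> R) (r h : R) :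
  (forall y, Rabs y < r -> ex_series (fun k => a k * y ^ k)) ->
  Rabs h < r -> Rbar_lt (Rabs h) (CV_radius a).
Proof.
  intros H Hh. set (y := (Rabs h + r) / 2).
  assert (Hy : Rabs h < y < r) by (unfold y; lra).
  pose proof (Rabs_pos h) as H0.
  apply Rbar_lt_le_trans with (Rabs y); [rewrite (Rabs_pos_eq y); simpl; lra|].
  destruct (Rbar_le_lt_dec (Rabs y) (CV_radius a)) as [Hc|Hc]; [exact Hc|].
  exfalso. apply (CV_disk_outside a y Hc).
  apply ex_series_lim_0. apply H. rewrite Rabs_pos_eq; lra.
Qed.

Lemma analytic_at_plus (f g : R -> R) (x : R) :
  @analytic_at R_AbsRing f x -> @analytic_at R_AbsRing g x ->
  @analytic_at R_AbsRing (fun y => f y + g y) x.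
Proof.
  rewrite !analytic_at_R. intros (a & r & Hr & Ha) (b & s & Hs & Hb).
  exists (fun k => a k + b k), (Rmin r s). split; [now apply Rmin_pos|].
  intros h Hh.
  apply is_series_ext_R with (fun k => a k * h ^ k + b k * h ^ k);
    [intros n; ring|].
  apply is_series_plus_R.
  - apply Ha. eapply Rlt_le_trans; [exact Hh | apply Rmin_l].
  - apply Hb. eapply Rlt_le_trans; [exact Hh | apply Rmin_r].
Qed.

Lemma analytic_at_mult (f g : R -> R) (x : R) :
  @analytic_at R_AbsRing f x -> @analytic_at R_AbsRing g x ->
  @analytic_at R_AbsRing (fun y => f y * g y) x.
Proof.
  rewrite !analytic_at_R. intros (a & r & Hr & Ha) (b & s & Hs & Hb).
  exists (PS_mult a b), (Rmin r s). split; [now apply Rmin_pos|].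
  intros h Hh.
  assert (Hhr : Rabs h < r) by (eapply Rlt_le_trans; [exact Hh | apply Rmin_l]).
  assert (Hhs : Rabs h < s) by (eapply Rlt_le_trans; [exact Hh | apply Rmin_r]).
  apply (proj1 (is_pseries_R _ _ _)), is_pseries_mult.
  - apply (proj2 (is_pseries_R _ _ _)), Ha, Hhr.
  - apply (proj2 (is_pseries_R _ _ _)), Hb, Hhs.
  - apply CV_radius_gt with r; [|exact Hhr]. intros y Hy. eexists. apply Ha, Hy.
  - apply CV_radius_gt with s; [|exact Hhs]. intros y Hy. eexists. apply Hb, Hy.
Qed.

(** Since [0 ^ 0 = 1], the sequence is [c, 0, 0, ...]. The same form serves for constants, for power
    series at [h = 0] and for the zero series. *)
Lemma is_series_single (c : R) : is_series (fun k => c * 0 ^ k) c.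
Proof.
  apply is_series_R. apply filterlim_ext with (fun _ => c); [|apply filterlim_const].
  intros n. induction n as [|n IH].
  - rewrite sum_O. simpl. ring.
  - rewrite sum_Sn, <- IH. unfold plus; simpl. ring.
Qed.

Lemma analytic_at_const (c x : R) : @analytic_at R_AbsRing (fun _ => c) x.
Proof.
  apply analytic_at_R. exists (fun k => c * 0 ^ k), 1. split; [lra|]. intros h _.
  apply is_series_ext_R with (2 := is_series_single c).
  intros [|n]; simpl; ring.
Qed.

Lemma analytic_at_scal (c : R) (f : R -> R) (x : R) :
  @analytic_at R_AbsRing f x -> @analytic_at R_AbsRing (fun y => c * f y) x.
Proof. intros H. apply analytic_at_mult; [apply analytic_at_const | exact H]. Qed.

Lemma analytic_at_minus (f g : R -> R) (x : R) :
  @analytic_at R_AbsRing f x -> @analytic_at R_AbsRing g x ->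
  @analytic_at R_AbsRing (fun y => f y - g y) x.
Proof.
  intros Hf Hg.
  apply (analytic_at_ext_loc (fun y => f y + (-1) * g y) _ _ 1 Rlt_0_1).
  - intros; ring.
  - apply analytic_at_plus; [exact Hf | now apply analytic_at_scal].
Qed.

Lemma is_series_exp (y : R) : is_series (fun k => / INR (Factorial.fact k) * y ^ k) (exp y).
Proof. apply (proj1 (is_pseries_R _ _ _)), is_exp_Reals. Qed.

Lemma analytic_at_continuous (f : R -> R) (x : R) :
  @analytic_at R_AbsRing f x -> filterlim f (locally x) (locally (f x)).
Proof.
  rewrite analytic_at_R. intros (a & r & Hr & H).
  assert (Hf : forall h, Rabs h < r -> f (x + h) = PSeries a h).
  { intros h Hh. symmetry. apply is_series_unique, H, Hh. }
  assert (Hc : continuity_pt (PSeries a) 0).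
  { apply PSeries_continuity. apply CV_radius_gt with r.
    - intros y Hy. eexists. apply H, Hy.
    - rewrite Rabs_R0. exact Hr. }
  apply continuity_pt_filterlim in Hc.
  rewrite <- (Rplus_0_r x) at 2. rewrite Hf by (rewrite Rabs_R0; exact Hr).
  apply filterlim_ext_loc with (fun y => PSeries a (y - x)).
  - exists (mkposreal r Hr). intros y Hy. change (Rabs (y - x) < r) in Hy.
    rewrite <- Hf by exact Hy. f_equal. ring.
  - apply (filterlim_comp _ _ _ (fun y => y - x) (PSeries a) _ (locally 0)); [|exact Hc].
    apply filterlim_locally_R; [apply locally_filter|]. intros eps He.
    exists (mkposreal eps He). intros y Hy. change (Rabs (y - x) < eps) in Hy.
    now rewrite Rminus_0_r.
Qed.

(** * Identity theorem on a half-line *)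

Lemma pseries_zero_right_0 (a : nat -> R) (r : R) :
  0 < r -> (forall h, Rabs h < r -> ex_series (fun k => a k * h ^ k)) ->
  (forall h, 0 < h < r -> is_series (fun k => a k * h ^ k) 0) ->
  a 0%nat = 0.
Proof.
  intros Hr He H0.
  assert (Hc : continuity_pt (PSeries a) 0).
  { apply PSeries_continuity. apply CV_radius_gt with r; [exact He|].
    rewrite Rabs_R0. exact Hr. }
  apply continuity_pt_filterlim in Hc. rewrite PSeries_0 in Hc.
  assert (Hz : filterlim (PSeries a) (at_right 0) (locally 0)).
  { apply filterlim_ext_loc with (fun _ => 0); [|apply filterlim_const].
    exists (mkposreal r Hr). intros y Hy Hy0. change (Rabs (y - 0) < r) in Hy.
    rewrite Rminus_0_r, Rabs_pos_eq in Hy by lra.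
    symmetry. apply is_series_unique, H0. lra. }
  apply (filterlim_locally_unique (F := at_right 0) (PSeries a)); [|exact Hz].
  eapply filterlim_filter_le_1; [|exact Hc]. apply filter_le_within.
Qed.

(** Vanishing on one side is all that is known at the left end of a zero set. Continuity gives
    [a 0 = 0]; division by [h] then leaves a series with shifted coefficients and the same
    hypotheses. *)
Lemma pseries_zero_right (a : nat -> R) (r : R) :
  0 < r -> (forall h, Rabs h < r -> ex_series (fun k => a k * h ^ k)) ->
  (forall h, 0 < h < r -> is_series (fun k => a k * h ^ k) 0) ->
  forall n, a n = 0.
Proof.
  intros Hr He H0 n. revert a He H0. induction n as [|n IH]; intros a He H0.
  { now apply (pseries_zero_right_0 a r). }
  pose proof (pseries_zero_right_0 a r Hr He H0) as Ha0.
  assert (Hs : forall h l : R, h <> 0 -> is_series (fun k => a k * h ^ k) l ->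
    is_series (fun k => a (S k) * h ^ k) (/ h * l)).
  { intros h l Hn Hl. apply is_series_ext_R with (fun k => / h * (a (S k) * h ^ (S k))).
    - intros k. simpl. field. exact Hn.
    - apply is_series_scal_R. apply (is_series_incr_1 (V := R_NormedModule) (fun k => a k * h ^ k)).
      replace (plus _ _) with l; [exact Hl|].
      rewrite Ha0. unfold plus, opp; simpl; ring. }
  apply (IH (fun k => a (S k))).
  (* At [h = 0], where division is impossible, the shifted series reduces to its constant term. *)
  - intros h Hh. destruct (Req_dec h 0) as [->|Hn].
    + exists (a 1%nat). apply is_series_ext_R with (2 := is_series_single _).
      intros [|k]; simpl; ring.
    + destruct (He h Hh) as [l Hl]. exists (/ h * l). now apply Hs.
  - intros h Hh. rewrite <- (Rmult_0_r (/ h)). apply Hs; [lra|]. now apply H0.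
Qed.

(** Let [- m] be the infimum of the points [>= a] beyond which [f] vanishes. If [- m > a], the power
    series at [- m] vanishes on the right, hence has zero coefficients, and [f] vanishes a little to
    the left of [- m] as well, a contradiction. *)
Lemma analytic_zero_continuation (f : R -> R) (a b : R) :
  (forall x, a < x -> @analytic_at R_AbsRing f x) ->
  (forall x, b < x -> f x = 0) -> a <= b ->
  forall x, a < x -> f x = 0.
Proof.
  intros Hf Hb Hab.
  (* Endpoints are recorded with opposite sign, so that the leftmost one becomes a supremum, as
     [completeness] requires. *)
  set (E := fun t => a <= - t /\ forall x, - t < x -> f x = 0).
  destruct (completeness E) as [m [Hub Hlub]].
  - exists (- a). intros t [Ht _]. lra.
  - exists (- b). split; [lra|]. intros x Hx. apply Hb. lra.
  - assert (Hm : forall x, - m < x -> f x = 0).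
    { intros x Hx. destruct (Rlt_dec (f x) 0) as [Hn|Hn];
        [|destruct (Rlt_dec 0 (f x)) as [Hp|Hp]; [|lra]].
      all: exfalso; apply (Rlt_irrefl m); apply Rle_lt_trans with (- x); [|lra];
        apply Hlub; intros t [Ht1 Ht2];
        destruct (Rle_dec t (- x)) as [Hle|Hgt]; [exact Hle|];
        specialize (Ht2 x ltac:(lra)); lra. }
    assert (Hma : a <= - m).
    { assert (m <= - a); [|lra]. apply Hlub. intros t [Ht _]. lra. }
    destruct (Rle_lt_or_eq_dec _ _ Hma) as [Hlt|Heq].
    + exfalso. pose proof (Hf _ Hlt) as Han. apply analytic_at_R in Han.
      destruct Han as (c & r & Hr & Hc).
      assert (Hc0 : forall n, c n = 0).
      { apply (pseries_zero_right c r Hr).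
        - intros h Hh. eexists. apply Hc, Hh.
        - intros h Hh. rewrite <- (Hm (- m + h)) by lra. apply Hc.
          rewrite Rabs_pos_eq; lra. }
      set (d := Rmin (r / 2) (- m - a)).
      assert (Hd : 0 < d) by (apply Rmin_pos; lra).
      assert (Hd1 : d <= r / 2) by apply Rmin_l.
      assert (Hd2 : d <= - m - a) by apply Rmin_r.
      assert (Hin : E (m + d)).
      { split; [lra|]. intros x Hx. destruct (Rlt_dec (- m) x) as [Hx'|Hx']; [now apply Hm|].
        assert (Hh : Rabs (x + m) < r) by (apply Rabs_def1; lra).
        specialize (Hc _ Hh). replace (- m + (x + m)) with x in Hc by ring.
        rewrite <- (is_series_unique _ _ Hc).
        rewrite (Series_ext _ (fun k => 0 * 0 ^ k)).
        - apply is_series_unique, is_series_single.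
        - intros n. rewrite Hc0. ring. }
      specialize (Hub _ Hin). lra.
    + intros x Hx. apply Hm. lra.
Qed.

(* The factor [/ 2 ^ k] is what lets the expansions be rearranged by
   [is_series_swap]. *)
Lemma analytic_at_Series (f : nat -> R -> R) (a : nat -> nat -> R) (m : nat -> R) (x r : R) :
  0 < r -> ex_series m ->
  (forall n k, Rabs (a n k) * r ^ k <= m n * / 2 ^ k) ->
  (forall n h, Rabs h < r -> is_series (fun k => a n k * h ^ k) (f n (x + h))) ->
  @analytic_at R_AbsRing (fun y => Series (fun n => f n y)) x.
Proof.
  intros Hr Hm Ha Hf. apply analytic_at_R.
  exists (fun k => Series (fun n => a n k)), r. split; [exact Hr|].
  intros h Hh.
  rewrite (Series_ext _ (fun n => Series (fun k => a n k * h ^ k))).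
  2: { intros n. symmetry. apply is_series_unique, Hf, Hh. }
  apply is_series_ext_R with (fun k => Series (fun n => a n k * h ^ k)).
  - intros k. apply Series_scal_r.
  - apply (is_series_swap (fun n k => a n k * h ^ k) m (fun k => / 2 ^ k)); [exact Hm| |].
    + apply ex_series_ext with (fun k => (/ 2) ^ k).
      * intros k. now rewrite pow_inv.
      * apply ex_series_geom. rewrite Rabs_pos_eq; lra.
    + intros n k. eapply Rle_trans; [|apply Ha].
      rewrite Rabs_mult, <- RPow_abs. apply Rmult_le_compat_l; [apply Rabs_pos|].
      apply pow_incr. split; [apply Rabs_pos | lra].
Qed.

(** * Second differences of powers *)

Definition diff2 (g : R -> R) (k : nat) : R :=
  2 * g (2 * INR k + 1) - g (2 * INR k + 1 / 2) - g (2 * INR k + 3 / 2).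

Lemma diff2_scal (c : R) (g : R -> R) (k : nat) :
  diff2 (fun x => c * g x) k = c * diff2 g k.
Proof. unfold diff2. ring. Qed.

Lemma filterlim_diff2 {T : Type} (F : (T -> Prop) -> Prop) (FF : Filter F)
  (g : T -> R -> R) (G : R -> R) (k : nat) :
  (forall x, 0 < x -> filterlim (fun t => g t x) F (locally (G x))) ->
  filterlim (fun t => diff2 (g t) k) F (locally (diff2 G k)).
Proof.
  intros H. pose proof (pos_INR k).
  assert (HG : diff2 G k = 2 * G (2 * INR k + 1) + (-1) * G (2 * INR k + 1 / 2)
    + (-1) * G (2 * INR k + 3 / 2)) by (unfold diff2; ring).
  rewrite HG.
  apply filterlim_ext with (fun t => 2 * g t (2 * INR k + 1)
    + (-1) * g t (2 * INR k + 1 / 2) + (-1) * g t (2 * INR k + 3 / 2)).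
  { intros t. unfold diff2. ring. }
  repeat apply filterlim_plus_R; try assumption; apply filterlim_scal_R; try assumption;
    apply H; lra.
Qed.

Lemma sum_n_diff2 (g : nat -> R -> R) (k n : nat) :
  sum_n (fun i => diff2 (g i) k) n = diff2 (fun x => sum_n (fun i => g i x) n) k.
Proof.
  induction n as [|n IH].
  - unfold diff2. now rewrite !sum_O.
  - rewrite sum_Sn, IH. unfold diff2. rewrite !sum_Sn. unfold plus; simpl. ring.
Qed.

Lemma is_series_diff2 (g : nat -> R -> R) (G : R -> R) (k : nat) :
  (forall x, 0 < x -> is_series (fun i => g i x) (G x)) ->
  is_series (fun i => diff2 (g i) k) (diff2 G k).
Proof.
  intros H. apply is_series_R.
  apply filterlim_ext with (fun n => diff2 (fun x => sum_n (fun i => g i x) n) k).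
  - intros n. now rewrite sum_n_diff2.
  - apply filterlim_diff2; [apply eventually_filter|]. intros x Hx. now apply H.
Qed.

(** [diff2] is the difference of the increments of [g] over two adjacent intervals of length 1/2,
    each controlled by the decrease of [h]. With index [S k] every point involved is at least [5/2];
    the exceptional points [1/2], [1], [3/2] belong to index 0. *)
Lemma diff2_bound (g h : R -> R) (c : R) (k : nat) :
  (forall x y, 5 / 2 <= x -> x <= y -> Rabs (g y - g x) <= c * (h x - h y)) ->
  Rabs (diff2 g (S k)) <=
    c * (h (2 * INR (S k) + 1 / 2) - h (2 * INR (S (S k)) + 1 / 2)).
Proof.
  intros H. rewrite (S_INR (S k)). pose proof (pos_INR k) as Hk. pose proof (S_INR k) as HSk.
  unfold diff2. set (y := INR (S k)) in *.
  pose proof (H (2 * y + 1 / 2) (2 * y + 1) ltac:(lra) ltac:(lra)) as H1.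
  pose proof (H (2 * y + 1) (2 * y + 3 / 2) ltac:(lra) ltac:(lra)) as H2.
  (* The interval up to the first point of the next index does not occur in [diff2]. The decrease of
     [h] over it, weighted by [c], is nonnegative, and adding it makes the bounds telescope. *)
  pose proof (H (2 * y + 3 / 2) (2 * (y + 1) + 1 / 2) ltac:(lra) ltac:(lra)) as H3.
  pose proof (Rabs_pos (g (2 * (y + 1) + 1 / 2) - g (2 * y + 3 / 2))) as H4.
  apply Rabs_le_between in H1. apply Rabs_le_between in H2.
  apply Rabs_le. lra.
Qed.

Lemma ex_series_telescope (d : nat -> R) (B : R) :
  (forall k, d (S k) <= d k) -> (forall k, B <= d k) ->
  ex_series (fun k => d k - d (S k)).
Proof.
  intros Hd HB. destruct (ex_finite_lim_seq_decr d B Hd HB) as [l Hl].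
  exists (d 0%nat + (-1) * l). apply is_series_R.
  apply filterlim_ext with (fun n => d 0%nat + (-1) * d (S n)).
  - intros n. induction n as [|n IH].
    + rewrite sum_O. ring.
    + rewrite sum_Sn, <- IH. unfold plus; simpl. ring.
  - apply filterlim_plus_R; [apply eventually_filter | apply filterlim_const|].
    apply filterlim_scal_R; [apply eventually_filter|].
    apply is_lim_seq_incr_1 in Hl. exact Hl.
Qed.

Lemma ex_series_exp_ln_telescope (p C : R) :
  0 < p -> 0 <= C ->
  ex_series (fun k => C * (exp (- p * ln (2 * INR (S k) + 1 / 2))
    - exp (- p * ln (2 * INR (S (S k)) + 1 / 2)))).
Proof.
  intros Hp HC. apply ex_series_scal_R.
  apply (ex_series_telescope (fun k => exp (- p * ln (2 * INR (S k) + 1 / 2))) 0).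
  - intros k. rewrite (S_INR (S k)). pose proof (pos_INR (S k)).
    apply exp_le_compat. assert (ln (2 * INR (S k) + 1 / 2) <= ln (2 * (INR (S k) + 1) + 1 / 2)).
    { apply ln_le; lra. }
    nra.
  - intros k. left. apply exp_pos.
Qed.

(* Both [g + h] and [g - h] are monotone. *)
Lemma Rabs_increment_le (g h g' h' : R -> R) (a b : R) :
  a <= b ->
  (forall x, a <= x <= b -> is_derive g x (g' x)) ->
  (forall x, a <= x <= b -> is_derive h x (h' x)) ->
  (forall x, a <= x <= b -> Rabs (g' x) <= - h' x) ->
  Rabs (g b - g a) <= h a - h b.
Proof.
  intros Hab Hg Hh Hb.
  assert (Hmin : Rmin a b = a) by now apply Rmin_left.
  assert (Hmax : Rmax a b = b) by now apply Rmax_right.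
  assert (Hgen : forall e, e = 1 \/ e = -1 -> h b + e * g b <= h a + e * g a).
  { intros e He.
    destruct (MVT_gen (fun x => h x + e * g x) a b (fun x => h' x + e * g' x)) as [c [Hc H]].
    - rewrite Hmin, Hmax. intros x Hx.
      apply (is_derive_plus (V := R_NormedModule)); [apply Hh; lra|].
      apply (is_derive_scal g x e). apply Hg; lra.
    - rewrite Hmin, Hmax. intros x Hx. apply continuity_pt_filterlim.
      apply (continuous_plus (V := R_NormedModule) h (fun x => e * g x)).
      + apply ex_derive_continuous. eexists. now apply Hh.
      + apply (continuous_scal_r (V := R_NormedModule) e g).
        apply ex_derive_continuous. eexists. now apply Hg.
    - rewrite Hmin, Hmax in Hc. specialize (Hb c Hc). apply Rabs_le_between in Hb.
      destruct He; subst e; nra. }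
  pose proof (Hgen 1 (or_introl eq_refl)). pose proof (Hgen (-1) (or_intror eq_refl)).
  apply Rabs_le. lra.
Qed.

(** * Taylor expansion of powers in the exponent *)

Lemma pow_fact_le_exp (y : R) (i : nat) : 0 <= y -> / INR (Factorial.fact i) * y ^ i <= exp y.
Proof.
  intros Hy. rewrite <- (is_series_unique _ _ (is_series_exp y)).
  assert (Hpos : forall k, 0 <= / INR (Factorial.fact k) * y ^ k).
  { intros k. apply Rmult_le_pos; [|now apply pow_le].
    left. apply Rinv_0_lt_compat, INR_fact_lt_0. }
  eapply Rle_trans; [|apply (sum_n_le_Series _ i Hpos)].
  - destruct i as [|i]; [rewrite sum_O; lra|]. rewrite sum_Sn.
    assert (H : 0 <= sum_n (fun k => / INR (Factorial.fact k) * y ^ k) i); [|unfold plus; simpl; simpl in *; lra].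
    replace 0 with (sum_n (fun _ : nat => 0) i).
    + apply sum_n_m_le. exact Hpos.
    + rewrite sum_n_const. apply Rmult_0_r.
  - eexists. apply is_series_exp.
Qed.

(** One term of the exponential series, taken at [2 r L] instead of [r L]: the spare [2 ^ i] is the
    geometric decay that [analytic_at_Series] asks for. *)
Lemma pow_fact_le_exp_geom (r L : R) (i : nat) : 0 <= r -> 0 <= L ->
  r ^ i * (/ INR (Factorial.fact i) * L ^ i) <= / 2 ^ i * exp (2 * r * L).
Proof.
  intros Hr HL. pose proof (pow_fact_le_exp (2 * r * L) i ltac:(nra)) as H.
  assert (H2 : 0 < 2 ^ i) by (apply pow_lt; lra).
  replace (r ^ i * (/ INR (Factorial.fact i) * L ^ i))
    with (/ 2 ^ i * (/ INR (Factorial.fact i) * (2 * r * L) ^ i)).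
  - apply Rmult_le_compat_l; [|exact H]. left. now apply Rinv_0_lt_compat.
  - rewrite !Rpow_mult_distr. field. split; [apply INR_fact_neq_0 | lra].
Qed.

Definition unit_bounded_derive (T T' : R -> R) : Prop :=
  forall y, is_derive T y (T' y) /\ Rabs (T y) <= 1 /\ Rabs (T' y) <= 1.

(* The coefficients of [h |-> exp (- (s + h) * ln x) * T (v * ln x)]. *)
Definition pow_trig_coef (T : R -> R) (v s : R) (i : nat) (x : R) : R :=
  / INR (Factorial.fact i) * (- ln x) ^ i * (exp (- s * ln x) * T (v * ln x)).

(** In the variable [L = ln x >= 0] the scaled coefficient [G] has a derivative of absolute value at
    most [(2r + s + v) / 2^i * exp (2rL) * exp (-sL)], which is minus the derivative of
    [c * exp (- (s - 2r) L)]. Lowering the exponent from [s] to [s - 2r] pays for the factor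
    [/ 2 ^ i]. *)
Lemma pow_trig_coef_increment (T T' : R -> R) (v s r : R) (i : nat) (x y : R) :
  unit_bounded_derive T T' -> 0 <= v ->
  0 < s -> 0 <= r -> 2 * r < s -> 1 <= x -> x <= y ->
  Rabs (pow_trig_coef T v s i y - pow_trig_coef T v s i x) * r ^ i <=
  / 2 ^ i * ((2 * r + s + v) / (s - 2 * r)) *
    (exp (- (s - 2 * r) * ln x) - exp (- (s - 2 * r) * ln y)).
Proof.
  intros HT Hv Hs Hr Hrs Hx Hxy.
  assert (H0x : 0 <= ln x) by (rewrite <- ln_1; apply ln_le; lra).
  assert (Hln : ln x <= ln y) by (apply ln_le; lra).
  set (p := s - 2 * r) in *. assert (Hp : 0 < p) by (unfold p; lra).
  set (c := / 2 ^ i * ((2 * r + s + v) / p)).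
  set (G := fun L => r ^ i * (/ INR (Factorial.fact i) * (- L) ^ i * (exp (- s * L) * T (v * L)))).
  assert (Hri : 0 <= r ^ i) by now apply pow_le.
  rewrite <- (Rabs_pos_eq (r ^ i)) by exact Hri.
  rewrite <- Rabs_mult.
  replace ((pow_trig_coef T v s i y - pow_trig_coef T v s i x) * r ^ i) with (G (ln y) - G (ln x))
    by (unfold G, pow_trig_coef; ring).
  replace (c * _) with (c * exp (- p * ln x) - c * exp (- p * ln y)) by ring.
  pose (G' := fun L => r ^ i * / INR (Factorial.fact i) *
    ((- INR i * (- L) ^ pred i - s * (- L) ^ i) * (exp (- s * L) * T (v * L))
     + (- L) ^ i * (exp (- s * L) * (v * T' (v * L))))).
  apply (Rabs_increment_le G (fun L => c * exp (- p * L)) G' (fun L => c * (- p * exp (- p * L)))); [exact Hln| | |].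
  - intros L _. unfold G, G'.
    auto_derive.
    + repeat split; eexists; apply (HT (v * L)).
    + replace (Derive (fun x0 : R => T x0) (v * L)) with (T' (v * L)); [ring|].
      symmetry. apply is_derive_unique, HT.
  - intros L _. auto_derive; [trivial | ring].
  - intros L HL. unfold G'.
    set (f := / INR (Factorial.fact i)).
    assert (Hf : 0 < f) by apply Rinv_0_lt_compat, INR_fact_lt_0.
    assert (HL0 : 0 <= L) by lra.
    assert (Hexp : 0 < exp (- s * L)) by apply exp_pos.
    assert (Habs : forall j, Rabs ((- L) ^ j) = L ^ j).
    { intros j. rewrite <- RPow_abs, Rabs_Ropp, Rabs_pos_eq by exact HL0. reflexivity. }
    assert (HLi : 0 <= L ^ i) by now apply pow_le.
    assert (HLp : 0 <= L ^ pred i) by now apply pow_le.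
    assert (Hi : 0 <= INR i) by apply pos_INR.
    assert (H1 : r ^ i * (f * L ^ i) <= / 2 ^ i * exp (2 * r * L)) by now apply pow_fact_le_exp_geom.
    (* As [i / i! = 1 / (i - 1)!], this is the estimate of order [i - 1] with one factor [r] left
       over; the halving lost with the lower order gives the 2. *)
    assert (H2 : r ^ i * (f * (INR i * L ^ pred i)) <= / 2 ^ i * (2 * r) * exp (2 * r * L)).
    { destruct i as [|j].
      - simpl INR. rewrite Rmult_0_l, !Rmult_0_r. simpl. pose proof (exp_pos (2 * r * L)).
        rewrite Rinv_1. nra.
      - pose proof (pow_fact_le_exp_geom r L j Hr HL0) as H.
        assert (H2 : 0 < 2 ^ j) by (apply pow_lt; lra).
        replace (r ^ S j * (f * (INR (S j) * L ^ pred (S j))))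
          with (r * (r ^ j * (/ INR (Factorial.fact j) * L ^ j))).
        + replace (/ 2 ^ S j * (2 * r) * exp (2 * r * L)) with (r * (/ 2 ^ j * exp (2 * r * L))).
          * apply Rmult_le_compat_l; [exact Hr | exact H].
          * simpl. field. lra.
        + unfold f. rewrite fact_simpl, mult_INR. simpl pred. simpl pow. field.
          split; [apply INR_fact_neq_0 | apply not_0_INR; lia]. }
    replace (- (c * (- p * exp (- p * L))))
      with ((/ 2 ^ i * (2 * r) * exp (2 * r * L) + (s + v) * (/ 2 ^ i * exp (2 * r * L))) * exp (- s * L)).
    2: { replace (- p * L) with (2 * r * L + - s * L) by (unfold p; ring).
         rewrite exp_plus. unfold c. field.
         split; [lra|]. apply pow_nonzero; lra. }
    eapply Rle_trans with ((r ^ i * (f * (INR i * L ^ pred i)) + (s + v) * (r ^ i * (f * L ^ i))) * exp (- s * L)).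
    2: { apply Rmult_le_compat_r; [lra|]. apply Rplus_le_compat; [exact H2|].
         apply Rmult_le_compat_l; [lra | exact H1]. }
    rewrite !Rabs_mult, (Rabs_pos_eq (r ^ i)), (Rabs_pos_eq f) by lra.
    replace ((r ^ i * (f * (INR i * L ^ pred i)) + (s + v) * (r ^ i * (f * L ^ i))) * exp (- s * L))
      with (r ^ i * f * ((INR i * L ^ pred i + s * L ^ i) * exp (- s * L) + L ^ i * (exp (- s * L) * v)))
      by ring.
    apply Rmult_le_compat_l; [apply Rmult_le_pos; lra|].
    eapply Rle_trans; [apply Rabs_triang|]. apply Rplus_le_compat.
    + rewrite !Rabs_mult. rewrite (Rabs_pos_eq (exp _)) by lra.
      apply Rmult_le_compat; [apply Rabs_pos | | |].
      * apply Rmult_le_pos; [lra | apply Rabs_pos].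
      * unfold Rminus. eapply Rle_trans; [apply Rabs_triang|].
        rewrite !Rabs_Ropp, !Rabs_mult, !Habs, Rabs_Ropp, (Rabs_pos_eq (INR i)), (Rabs_pos_eq s) by lra. lra.
      * pose proof (proj1 (proj2 (HT (v * L)))). nra.
    + rewrite !Rabs_mult, Habs, (Rabs_pos_eq (exp _)), (Rabs_pos_eq v) by lra.
      apply Rmult_le_compat_l; [lra|]. apply Rmult_le_compat_l; [lra|].
      pose proof (proj2 (proj2 (HT (v * L)))). nra.
Qed.

Lemma is_series_pow_trig (T : R -> R) (v s h x : R) :
  is_series (fun i => pow_trig_coef T v s i x * h ^ i) (exp (- (s + h) * ln x) * T (v * ln x)).
Proof.
  replace (exp (- (s + h) * ln x) * T (v * ln x))
    with (exp (- s * ln x) * T (v * ln x) * exp (- ln x * h)).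
  2: { replace (- (s + h) * ln x) with (- s * ln x + - ln x * h) by ring.
       rewrite exp_plus. ring. }
  apply is_series_ext_R with
    (fun i => exp (- s * ln x) * T (v * ln x) * (/ INR (Factorial.fact i) * (- ln x * h) ^ i)).
  - intros i. unfold pow_trig_coef. rewrite Rpow_mult_distr. ring.
  - apply is_series_scal_R, is_series_exp.
Qed.

Lemma diff2_pow_trig_bound (T T' : R -> R) (v s : R) (k : nat) :
  unit_bounded_derive T T' -> 0 <= v ->
  0 < s ->
  Rabs (diff2 (fun x => exp (- s * ln x) * T (v * ln x)) (S k)) <=
  (s + v) / s * (exp (- s * ln (2 * INR (S k) + 1 / 2))
                 - exp (- s * ln (2 * INR (S (S k)) + 1 / 2))).
Proof.
  intros HT Hv Hs. apply (diff2_bound _ (fun x => exp (- s * ln x))). intros x y Hx Hxy.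
  (* At order 0 and radius 0 the coefficient is the function itself. *)
  pose proof (pow_trig_coef_increment T T' v s 0 0 x y HT Hv Hs (Rle_refl 0) ltac:(lra) ltac:(lra) Hxy) as H.
  unfold pow_trig_coef in H. simpl in H.
  rewrite Rmult_0_r, Rminus_0_r, Rplus_0_l, Rinv_1, !Rmult_1_l, !Rmult_1_r in H. exact H.
Qed.

Lemma ex_series_diff2_pow_trig (T T' : R -> R) (v s : R) :
  unit_bounded_derive T T' -> 0 <= v ->
  0 < s -> ex_series (diff2 (fun x => exp (- s * ln x) * T (v * ln x))).
Proof.
  intros HT Hv Hs. apply ex_series_incr_1.
  apply ex_series_dom with (2 := fun k => diff2_pow_trig_bound T T' v s k HT Hv Hs).
  apply ex_series_exp_ln_telescope; [exact Hs|].
  apply Rmult_le_pos; [lra|]. left. now apply Rinv_0_lt_compat.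
Qed.

Lemma analytic_at_pow_trig (T : R -> R) (v x s : R) :
  @analytic_at R_AbsRing (fun s => exp (- s * ln x) * T (v * ln x)) s.
Proof.
  apply analytic_at_R. exists (fun i => pow_trig_coef T v s i x), 1. split; [lra|].
  intros h _. apply is_series_pow_trig.
Qed.

Lemma analytic_at_Series_pow_trig (T T' : R -> R) (v s : R) :
  unit_bounded_derive T T' -> 0 <= v ->
  0 < s ->
  @analytic_at R_AbsRing (fun s => Series (diff2 (fun x => exp (- s * ln x) * T (v * ln x)))) s.
Proof.
  intros HT Hv Hs.
  (* The term [k = 0] is split off: it involves the point [1/2], where [ln] is negative and the
     increment bound does not apply. *)
  apply (analytic_at_ext_loc
    (fun s => diff2 (fun x => exp (- s * ln x) * T (v * ln x)) 0
      + Series (fun k => diff2 (fun x => exp (- s * ln x) * T (v * ln x)) (S k))) _ _ s Hs).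
  { intros t Ht. symmetry. apply Series_incr_1, (ex_series_diff2_pow_trig T T'); [exact HT | exact Hv |].
    apply Rabs_def2 in Ht. lra. }
  apply analytic_at_plus.
  - unfold diff2. apply analytic_at_minus; [apply analytic_at_minus; [apply analytic_at_scal|]|];
      apply analytic_at_pow_trig.
  (* Any [r] with [0 < 2 r < s] would do. *)
  - set (r := s / 4).
    apply (analytic_at_Series _ (fun k i => diff2 (pow_trig_coef T v s i) (S k))
      (fun k => (2 * r + s + v) / (s - 2 * r) * (exp (- (s - 2 * r) * ln (2 * INR (S k) + 1 / 2))
                 - exp (- (s - 2 * r) * ln (2 * INR (S (S k)) + 1 / 2)))) s r).
    + unfold r; lra.
    + apply ex_series_exp_ln_telescope; [unfold r; lra|].
      apply Rmult_le_pos; [unfold r; lra|]. left. apply Rinv_0_lt_compat. unfold r; lra.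
    + intros k i. assert (Hri : 0 < r ^ i) by (apply pow_lt; unfold r; lra).
      rewrite <- (Rabs_pos_eq (r ^ i)) by lra. rewrite <- Rabs_mult, Rmult_comm, <- diff2_scal.
      rewrite (Rmult_comm _ (/ 2 ^ i)), <- Rmult_assoc.
      apply (diff2_bound _ (fun x => exp (- (s - 2 * r) * ln x))).
      intros x y Hx Hxy. rewrite <- Rmult_minus_distr_l, Rmult_comm, Rabs_mult.
      rewrite (Rabs_pos_eq (r ^ i)) by lra.
      apply (pow_trig_coef_increment T T'); try assumption; try lra; unfold r; lra.
    + intros k h _.
      apply is_series_ext_R with (fun i => diff2 (fun x => pow_trig_coef T v s i x * h ^ i) (S k)).
      { intros i. unfold diff2. ring. }
      apply is_series_diff2. intros x Hx. apply is_series_pow_trig.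
Qed.


(** * The zeta function on a vertical line *)

Lemma sum_n_Re (a : nat -> C) (n : nat) :
  Re (sum_n (G := C_AbelianMonoid) a n) = sum_n (fun k => Re (a k)) n.
Proof.
  induction n as [|n IH]; [now rewrite !sum_O|].
  rewrite !sum_Sn, <- IH. reflexivity.
Qed.

Lemma sum_n_Im (a : nat -> C) (n : nat) :
  Im (sum_n (G := C_AbelianMonoid) a n) = sum_n (fun k => Im (a k)) n.
Proof.
  induction n as [|n IH]; [now rewrite !sum_O|].
  rewrite !sum_Sn, <- IH. reflexivity.
Qed.

Lemma is_series_C_Re_Im (a : nat -> C) (l : C) :
  @is_series C_AbsRing C_NormedModule a l ->
  is_series (fun k => Re (a k)) (Re l) /\ is_series (fun k => Im (a k)) (Im l).
Proof.
  intros H.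
  assert (Hb : forall eps : R, 0 < eps ->
    eventually (fun n => @ball C_UniformSpace l eps (sum_n (G := C_AbelianMonoid) a n))).
  { intros eps He. exact (proj1 (filterlim_locally _ l) H (mkposreal eps He)). }
  split; apply is_series_R; apply (filterlim_locally_R _ _); intros eps He;
    generalize (Hb eps He); apply filter_imp; intros n Hn.
  - rewrite <- sum_n_Re. exact (proj1 Hn).
  - rewrite <- sum_n_Im. exact (proj2 Hn).
Qed.

(** Counterpart for the structure used by [analytic_at], whose balls are given by [Cmod]; those of
    [C_NormedModule], in which the Dirichlet series converges, are products of real balls. *)
Lemma is_series_C_AbsRing_Re_Im (a : nat -> C) (l : C) :
  @is_series C_AbsRing (AbsRing_NormedModule C_AbsRing) a l ->
  is_series (fun k => Re (a k)) (Re l) /\ is_series (fun k => Im (a k)) (Im l).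
Proof.
  intros H.
  assert (Hb : forall eps : R, 0 < eps ->
    eventually (fun n => Rmax (Rabs (fst (sum_n (G := C_AbelianMonoid) a n - l)%C))
      (Rabs (snd (sum_n (G := C_AbelianMonoid) a n - l)%C)) < eps)).
  { intros eps He.
    generalize (proj1 (filterlim_locally (U := AbsRing_UniformSpace C_AbsRing) _ l) H (mkposreal eps He)).
    apply filter_imp. intros n Hn. eapply Rle_lt_trans; [apply Rmax_Cmod | exact Hn]. }
  split; apply is_series_R; apply (filterlim_locally_R _ _); intros eps He;
    generalize (Hb eps He); apply filter_imp; intros n Hn.
  - rewrite <- sum_n_Re. eapply Rle_lt_trans; [apply Rmax_l | exact Hn].
  - rewrite <- sum_n_Im. eapply Rle_lt_trans; [apply Rmax_r | exact Hn].
Qed.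

Lemma pow_n_RtoC (h : R) (k : nat) : @pow_n C_Ring (RtoC h) k = RtoC (h ^ k).
Proof.
  induction k as [|k IH]; [reflexivity|].
  simpl. rewrite IH. unfold mult; simpl. unfold RtoC, Cmult; simpl. f_equal; ring.
Qed.

(** Increments along a horizontal line are real, and so are their powers: the real and imaginary
    parts of the complex coefficients are themselves Taylor coefficients. *)
Lemma analytic_at_horizontal (f : C -> C) (s v : R) :
  @analytic_at C_AbsRing f (s, v) ->
  @analytic_at R_AbsRing (fun x => Re (f (x, v))) s /\
  @analytic_at R_AbsRing (fun x => Im (f (x, v))) s.
Proof.
  intros [a [[r Hr] H]].
  assert (Hs : forall h, Rabs h < r ->
    is_series (fun k => Re (a k) * h ^ k) (Re (f (s + h, v))) /\
    is_series (fun k => Im (a k) * h ^ k) (Im (f (s + h, v)))).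
  { intros h Hh.
    assert (Hm : minus (G := C_AbsRing) ((s + h, v) : C) ((s, v) : C) = RtoC h).
    { unfold minus, plus, opp; simpl. unfold Cplus, Copp, RtoC; simpl. f_equal; ring. }
    assert (Hy : is_pseries (V := AbsRing_NormedModule C_AbsRing) a (RtoC h) (f (s + h, v))).
    { rewrite <- Hm. apply H.
      change (Cmod (minus (G := C_AbsRing) ((s + h, v) : C) ((s, v) : C)) < r).
      rewrite Hm, Cmod_R. exact Hh. }
    apply is_series_C_AbsRing_Re_Im in Hy.
    assert (Hk : forall k, scal (pow_n (K := C_Ring) (RtoC h) k) (a k)
      = (Re (a k) * h ^ k, Im (a k) * h ^ k)).
    { intros k. rewrite pow_n_RtoC. destruct (a k) as [p q].
      unfold scal; simpl. unfold mult; simpl. unfold Cmult, RtoC; simpl. f_equal; ring. }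
    destruct Hy as [H1 H2]. split.
    - apply is_series_ext_R with (2 := H1). intros k. exact (f_equal Re (Hk k)).
    - apply is_series_ext_R with (2 := H2). intros k. exact (f_equal Im (Hk k)). }
  split; apply analytic_at_R.
  - exists (fun k => Re (a k)), r. split; [exact Hr|]. intros h Hh. apply Hs, Hh.
  - exists (fun k => Im (a k)), r. split; [exact Hr|]. intros h Hh. apply Hs, Hh.
Qed.

Definition re_pow (s v x : R) : R := exp (- s * ln x) * cos (v * ln x).
(** The sign is attached to the sine, so that the shape is [exp (- s * ln x) * T (v * ln x)] with
    [T] as in [unit_bounded_derive]. *)
Definition im_pow (s v x : R) : R := exp (- s * ln x) * - sin (v * ln x).

Lemma dirichlet_term_re_im (s v : R) (n : nat) :
  dirichlet_term (s, v) n = (re_pow s v (INR n), im_pow s v (INR n)).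
Proof.
  unfold dirichlet_term, Cexp, re_pow, im_pow. simpl.
  replace (- s * ln (INR n) - - v * 0) with (- s * ln (INR n)) by ring.
  replace (- s * 0 + - v * ln (INR n)) with (- (v * ln (INR n))) by ring.
  rewrite cos_neg, sin_neg. reflexivity.
Qed.

Lemma im_pow_mult (s v x y : R) : 0 < x -> 0 < y ->
  im_pow s v (x * y) = re_pow s v x * im_pow s v y + im_pow s v x * re_pow s v y.
Proof.
  intros Hx Hy. unfold re_pow, im_pow. rewrite ln_mult by assumption.
  rewrite !Rmult_plus_distr_l, exp_plus, sin_plus. ring.
Qed.

(* Imaginary part of
   [sum_{k <= N} diff2 x^-s = - 2^s S_(4N+4) + 3 S_(2N+2) - 2 2^-s S_(N+1)],
   where [S_n = sum_{m <= n} m^-s]: the left side gives [(m/2)^-s] the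
   coefficients -1, 2, -1, 0 periodically in [m], and so does the right side. *)
Lemma sum_n_diff2_im_pow (s v : R) (N : nat) :
  sum_n (diff2 (im_pow s v)) N =
  - (re_pow s v (1 / 2) * sum_n (fun k => im_pow s v (INR (S k))) (4 * N + 3)
     + im_pow s v (1 / 2) * sum_n (fun k => re_pow s v (INR (S k))) (4 * N + 3))
  + 3 * sum_n (fun k => im_pow s v (INR (S k))) (2 * N + 1)
  - 2 * (re_pow s v 2 * sum_n (fun k => im_pow s v (INR (S k))) N
         + im_pow s v 2 * sum_n (fun k => re_pow s v (INR (S k))) N).
Proof.
  set (X := re_pow s v). set (Y := im_pow s v).
  (* One period, used with [x = 2N + 1]: four new terms of the longest Dirichlet sum, two of the
     middle one, one of the shortest. At [x + 1] the coefficients cancel, [-1 + 3 - 2 = 0]. *)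
  assert (Hstep : forall x, 1 / 2 < x ->
    2 * Y x - Y (x - 1 / 2) - Y (x + 1 / 2) =
    - (X (1 / 2) * (Y (2 * x - 1) + Y (2 * x) + Y (2 * x + 1) + Y (2 * x + 2))
       + Y (1 / 2) * (X (2 * x - 1) + X (2 * x) + X (2 * x + 1) + X (2 * x + 2)))
    + 3 * (Y x + Y (x + 1))
    - 2 * (X 2 * Y ((x + 1) / 2) + Y 2 * X ((x + 1) / 2))).
  { intros x Hx.
    assert (H : forall y, 0 < y -> X (1 / 2) * Y y + Y (1 / 2) * X y = Y (y / 2)).
    { intros y Hy. unfold X, Y. replace (y / 2) with (1 / 2 * y) by field.
      rewrite im_pow_mult by lra. ring. }
    assert (H2 : X 2 * Y ((x + 1) / 2) + Y 2 * X ((x + 1) / 2) = Y (x + 1)).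
    { unfold X, Y. replace (x + 1) with (2 * ((x + 1) / 2)) at 3 by field.
      rewrite im_pow_mult by lra. ring. }
    rewrite H2.
    pose proof (H (2 * x - 1) ltac:(lra)) as E1. pose proof (H (2 * x) ltac:(lra)) as E2.
    pose proof (H (2 * x + 1) ltac:(lra)) as E3. pose proof (H (2 * x + 2) ltac:(lra)) as E4.
    replace ((2 * x - 1) / 2) with (x - 1 / 2) in E1 by field.
    replace (2 * x / 2) with x in E2 by field.
    replace ((2 * x + 1) / 2) with (x + 1 / 2) in E3 by field.
    replace ((2 * x + 2) / 2) with (x + 1) in E4 by field.
    lra. }
  induction N as [|N IH].
  - pose proof (Hstep 1 ltac:(lra)) as H.
    simpl Nat.add. simpl Nat.mul. rewrite !sum_Sn_R, !sum_O.
    simpl INR. unfold diff2. simpl INR.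
    replace (2 * 0 + 1) with 1 by ring. replace (2 * 0 + 1 / 2) with (1 - 1 / 2) by field.
    replace (2 * 0 + 3 / 2) with (1 + 1 / 2) by field.
    replace (2 * 1 - 1) with 1 in H by ring. replace (2 * 1 + 1) with (1 + 1 + 1) in H by ring.
    replace (2 * 1 + 2) with (1 + 1 + 1 + 1) in H by ring. replace (2 * 1) with (1 + 1) in H by ring.
    replace ((1 + 1) / 2) with 1 in H by field. replace 2 with (1 + 1) in * by ring. lra.
  - pose proof (pos_INR (S N)) as HN.
    pose proof (Hstep (2 * INR (S N) + 1) ltac:(lra)) as H.
    replace (4 * S N + 3)%nat with (S (S (S (S (4 * N + 3))))) by lia.
    replace (2 * S N + 1)%nat with (S (S (2 * N + 1))) by lia.
    rewrite !sum_Sn_R, IH.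
    replace (INR (S (S (4 * N + 3)))) with (2 * (2 * INR (S N) + 1) - 1)
      by (rewrite !S_INR, plus_INR, mult_INR; simpl; ring).
    replace (INR (S (S (S (4 * N + 3))))) with (2 * (2 * INR (S N) + 1))
      by (rewrite !S_INR, plus_INR, mult_INR; simpl; ring).
    replace (INR (S (S (S (S (4 * N + 3)))))) with (2 * (2 * INR (S N) + 1) + 1)
      by (rewrite !S_INR, plus_INR, mult_INR; simpl; ring).
    replace (INR (S (S (S (S (S (4 * N + 3))))))) with (2 * (2 * INR (S N) + 1) + 2)
      by (rewrite !S_INR, plus_INR, mult_INR; simpl; ring).
    replace (INR (S (S (2 * N + 1)))) with (2 * INR (S N) + 1)
      by (rewrite !S_INR, plus_INR, mult_INR; simpl; ring).
    replace (INR (S (S (S (2 * N + 1))))) with (2 * INR (S N) + 1 + 1)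
      by (rewrite !S_INR, plus_INR, mult_INR; simpl; ring).
    replace ((2 * INR (S N) + 1 + 1) / 2) with (INR (S (S N))) in H
      by (rewrite (S_INR (S N)); field).
    unfold diff2.
    replace (2 * INR (S N) + 1 / 2) with (2 * INR (S N) + 1 - 1 / 2) by field.
    replace (2 * INR (S N) + 3 / 2) with (2 * INR (S N) + 1 + 1 / 2) by field.
    lra.
Qed.

Lemma Rabs_sin_le_1 (x : R) : Rabs (sin x) <= 1.
Proof. apply Rabs_le, SIN_bound. Qed.

Lemma Rabs_cos_le_1 (x : R) : Rabs (cos x) <= 1.
Proof. apply Rabs_le, COS_bound. Qed.

Lemma unit_bounded_derive_neg_sin : unit_bounded_derive (fun y => - sin y) (fun y => - cos y).
Proof.
  intros y. split; [|split].
  - auto_derive; [trivial | ring].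
  - rewrite Rabs_Ropp. apply Rabs_sin_le_1.
  - rewrite Rabs_Ropp. apply Rabs_le, COS_bound.
Qed.

Lemma filterlim_nat_comp (f : nat -> R) (g : nat -> nat) (l : R) :
  (forall n, (n <= g n)%nat) -> filterlim f eventually (locally l) ->
  filterlim (fun n => f (g n)) eventually (locally l).
Proof.
  intros Hg Hf. apply (filterlim_comp _ _ _ g f _ eventually); [|exact Hf].
  intros P [n Hn]. exists n. intros m Hm. apply Hn. specialize (Hg m). lia.
Qed.


(** These are the two parts of [3 - 2^s - 2^(1-s)] at [s + i v]; [2^s] enters as [(1/2)^-s]. *)
Definition zeta_factor_re (s v : R) : R := 3 - re_pow s v (1 / 2) - 2 * re_pow s v 2.
Definition zeta_factor_im (s v : R) : R := - im_pow s v (1 / 2) - 2 * im_pow s v 2.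

(** The left side is the imaginary part of the product of zeta with its factor. As [v > 0], the line
    misses the pole, so the difference of both sides is real analytic for [s > 0]; it vanishes for
    [s > 1], where the three Dirichlet sums converge. *)
Lemma Im_zeta_diff2 (zeta : C -> C) (s v : R) :
  is_riemann_zeta zeta -> 0 < v -> 0 < s ->
  zeta_factor_re s v * Im (zeta (s, v)) + zeta_factor_im s v * Re (zeta (s, v)) =
  Series (diff2 (im_pow s v)).
Proof.
  intros [Hser Han] Hv Hs.
  assert (Hne : forall x, (x, v) <> RtoC 1).
  { intros x Hx. apply (f_equal snd) in Hx. simpl in Hx. lra. }
  apply Rminus_diag_uniq.
  apply (analytic_zero_continuation (fun s => zeta_factor_re s v * Im (zeta (s, v))
    + zeta_factor_im s v * Re (zeta (s, v)) - Series (diff2 (im_pow s v))) 0 1); [| | lra | exact Hs].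
  - intros x Hx. destruct (analytic_at_horizontal zeta x v (Han _ (Hne x))) as [HRe HIm].
    pose proof (analytic_at_pow_trig cos v) as Hc.
    pose proof (analytic_at_pow_trig (fun y => - sin y) v) as Hn.
    apply analytic_at_minus; [apply analytic_at_plus; apply analytic_at_mult|]; try assumption.
    + unfold zeta_factor_re. apply analytic_at_minus; [apply analytic_at_minus|].
      * apply analytic_at_const.
      * apply Hc.
      * apply analytic_at_scal. apply Hc.
    + unfold zeta_factor_im. apply analytic_at_minus; [|apply analytic_at_scal; apply Hn].
      apply (analytic_at_ext_loc (fun s => (-1) * im_pow s v (1 / 2)) _ _ 1 Rlt_0_1);
        [intros; ring|]. apply analytic_at_scal. apply Hn.
    + apply (analytic_at_Series_pow_trig _ _ v x unit_bounded_derive_neg_sin); lra.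
  - intros x Hx. apply Rminus_diag_eq. symmetry. apply is_series_unique, is_series_R.
    destruct (is_series_C_Re_Im _ _ (Hser (x, v) Hx)) as [HA HB].
    apply is_series_ext_R with (b := fun k => re_pow x v (INR (S k))) in HA;
      [|intros n; now rewrite dirichlet_term_re_im].
    apply is_series_ext_R with (b := fun k => im_pow x v (INR (S k))) in HB;
      [|intros n; now rewrite dirichlet_term_re_im].
    apply (proj1 (is_series_R _ _)) in HA. apply (proj1 (is_series_R _ _)) in HB.
    pose proof (filterlim_nat_comp _ (fun n => (4 * n + 3)%nat) _ ltac:(intros; cbv beta; lia) HA) as HA4.
    pose proof (filterlim_nat_comp _ (fun n => (4 * n + 3)%nat) _ ltac:(intros; cbv beta; lia) HB) as HB4.
    pose proof (filterlim_nat_comp _ (fun n => (2 * n + 1)%nat) _ ltac:(intros; cbv beta; lia) HB) as HB2.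
    pose proof (eventually_filter) as Hev.
    pose proof (filterlim_plus_R _ _ _ _ _ _
      (filterlim_plus_R _ _ _ _ _ _
        (filterlim_plus_R _ _ _ _ _ _
         (filterlim_scal_R _ _ (- re_pow x v (1 / 2)) _ _ HB4)
         (filterlim_scal_R _ _ (- im_pow x v (1 / 2)) _ _ HA4))
        (filterlim_scal_R _ _ 3 _ _ HB2))
      (filterlim_plus_R _ _ _ _ _ _
        (filterlim_scal_R _ _ (- 2 * re_pow x v 2) _ _ HB)
        (filterlim_scal_R _ _ (- 2 * im_pow x v 2) _ _ HA))) as Hlim.
    match type of Hlim with filterlim _ _ (locally ?l) =>
      replace (zeta_factor_re x v * Im (zeta (x, v)) + zeta_factor_im x v * Re (zeta (x, v))) with l
        by (unfold zeta_factor_re, zeta_factor_im; ring) end.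
    apply filterlim_ext with (2 := Hlim).
    intros N. simpl. rewrite sum_n_diff2_im_pow. simpl. ring.
Qed.

(** On the critical line [2^s] and [2^(1-s)] are complex conjugates: the factor is real, and the
    real part of zeta drops out. *)
Lemma zeta_weight_Series (zeta : C -> C) (v : R) :
  is_riemann_zeta zeta -> 0 < v ->
  zeta_weight zeta v = Series (diff2 (im_pow (1 / 2) v)).
Proof.
  intros Hz Hv. rewrite <- (Im_zeta_diff2 zeta) by (assumption || lra).
  assert (Hh : ln (1 / 2) = - ln 2).
  { replace (1 / 2) with (/ 2) by field. apply ln_Rinv; lra. }
  assert (E1 : exp (1 / 2 * ln 2) = sqrt 2).
  { rewrite <- (exp_ln (sqrt 2)) by (apply sqrt_lt_R0; lra). f_equal.
    assert (Hs : 0 < sqrt 2) by (apply sqrt_lt_R0; lra).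
    replace (ln 2) with (ln (sqrt 2 * sqrt 2)) by (rewrite sqrt_sqrt by lra; reflexivity).
    rewrite ln_mult by exact Hs. field. }
  assert (E2 : exp (- (1 / 2) * ln 2) = sqrt 2 / 2).
  { replace (- (1 / 2) * ln 2) with (1 / 2 * ln 2 + - ln 2) by field.
    rewrite exp_plus, exp_Ropp, exp_ln, E1 by lra. field. }
  unfold zeta_weight, zeta_factor_re, zeta_factor_im, re_pow, im_pow.
  rewrite Hh.
  replace (- (1 / 2) * - ln 2) with (1 / 2 * ln 2) by field.
  replace (v * - ln 2) with (- (v * ln 2)) by ring.
  rewrite cos_neg, sin_neg, E1, E2. field.
Qed.

(** * Fourier series at the origin *)

Lemma is_RInt_antiderivative (F f : R -> R) (a b : R) :
  (forall x, is_derive F x (f x)) -> (forall x, ex_derive f x) ->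
  is_RInt f a b (F b - F a).
Proof.
  intros HF Hf. apply (is_RInt_derive (V := R_CompleteNormedModule) F f).
  - intros x _. apply HF.
  - intros x _. apply (ex_derive_continuous (V := R_NormedModule)), Hf.
Qed.

Lemma sinh_Rabs_le (z : R) : Rabs (sinh z) <= Rabs z * exp (Rabs z).
Proof.
  assert (Hp : forall y, 0 <= y -> 0 <= sinh y <= y * exp y).
  { intros y Hy. unfold sinh.
    assert (H1 : exp (- y) = exp y * exp (- (2 * y))).
    { rewrite <- exp_plus. f_equal. ring. }
    pose proof (exp_pos y) as H2. pose proof (exp_ineq1_le (- (2 * y))) as H3.
    pose proof (exp_le_compat (- y) y ltac:(lra)) as H4.
    rewrite H1 in *. split; nra. }
  destruct (Rle_dec 0 z) as [Hz|Hz].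
  - rewrite (Rabs_pos_eq z Hz). rewrite Rabs_pos_eq by apply Hp, Hz. apply Hp, Hz.
  - rewrite (Rabs_left z) by lra. specialize (Hp (- z) ltac:(lra)).
    replace (sinh z) with (- sinh (- z)) by (unfold sinh; rewrite Ropp_involutive; field).
    rewrite Rabs_Ropp, Rabs_pos_eq; lra.
Qed.

Lemma sin_Rabs_le (z : R) : Rabs (sin z) <= Rabs z.
Proof.
  assert (Hp : forall y, 0 <= y -> Rabs (sin y) <= y).
  { intros y Hy. pose proof (Rabs_increment_le sin (fun y => - y) cos (fun _ => -1) 0 y Hy) as H.
    rewrite sin_0 in H. replace (sin y - 0) with (sin y) in H by ring.
    replace (- 0 - - y) with y in H by ring. apply H.
    - intros x _. auto_derive; [trivial | ring].
    - intros x _. auto_derive; [trivial | ring].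
    - intros x _. replace (- -1) with 1 by ring. apply Rabs_cos_le_1. }
  destruct (Rle_dec 0 z) as [Hz|Hz].
  - rewrite (Rabs_pos_eq z Hz). now apply Hp.
  - rewrite <- (Rabs_Ropp z), (Rabs_pos_eq (- z)) by lra.
    replace (sin z) with (- sin (- z)) by (rewrite sin_neg; ring).
    rewrite Rabs_Ropp. apply Hp. lra.
Qed.

(** The half-argument formulas turn [cosh - 1] and [1 - cos] into squares, hence the absence of a
    linear term. A quadratic deviation is what [cesaro_fourier_zero] needs to offset its kernel. *)
Lemma cosh_cos_quadratic (a p : R) :
  exists M, forall t, 0 <= t <= 1 / 2 -> Rabs (cosh (a * t) * cos (p * t) - 1) <= M * t ^ 2.
Proof.
  set (A := Rabs a * exp (Rabs a)). exists (A ^ 2 + p ^ 2). intros t Ht.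
  assert (H1 : cosh (a * t) - 1 = 2 * sinh (a * t / 2) ^ 2).
  { unfold cosh, sinh. replace (a * t) with (a * t / 2 + a * t / 2) by field.
    replace (- (a * t / 2 + a * t / 2)) with (- (a * t / 2) + - (a * t / 2)) by field.
    rewrite !exp_plus. replace ((a * t / 2 + a * t / 2) / 2) with (a * t / 2) by field.
    assert (exp (a * t / 2) * exp (- (a * t / 2)) = 1) by (rewrite <- exp_plus, Rplus_opp_r; apply exp_0).
    nra. }
  assert (H2 : 1 - cos (p * t) = 2 * sin (p * t / 2) ^ 2).
  { replace (p * t) with (2 * (p * t / 2)) at 1 by field. rewrite cos_2a_sin. ring. }
  assert (H3 : sinh (a * t / 2) ^ 2 <= (A * t / 2) ^ 2).
  { rewrite <- (pow2_abs (sinh _)). apply pow_incr. split; [apply Rabs_pos|].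
    eapply Rle_trans; [apply sinh_Rabs_le|].
    assert (Rabs (a * t / 2) = Rabs a * (t / 2)) as ->.
    { unfold Rdiv. rewrite Rmult_assoc, Rabs_mult, (Rabs_pos_eq (t * / 2)); lra. }
    unfold A. pose proof (Rabs_pos a) as Ha.
    pose proof (exp_le_compat (Rabs a * (t / 2)) (Rabs a) ltac:(nra)) as He.
    assert (0 <= Rabs a * (t / 2)) by nra. nra. }
  assert (H4 : sin (p * t / 2) ^ 2 <= (p * t / 2) ^ 2).
  { rewrite <- (pow2_abs (sin _)), <- (pow2_abs (p * t / 2)). apply pow_incr.
    split; [apply Rabs_pos | apply sin_Rabs_le]. }
  replace (cosh (a * t) * cos (p * t) - 1)
    with ((cosh (a * t) - 1) * cos (p * t) - (1 - cos (p * t))) by ring.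
  rewrite H1, H2. pose proof (COS_bound (p * t)) as Hc.
  pose proof (pow2_ge_0 (sinh (a * t / 2))). pose proof (pow2_ge_0 (sin (p * t / 2))).
  pose proof (pow2_ge_0 (A * t)). pose proof (pow2_ge_0 (p * t)).
  apply Rabs_le. split; nra.
Qed.

Lemma sinh_sin_quadratic (a p : R) :
  exists M, forall t, 0 <= t <= 1 / 2 -> Rabs (sinh (a * t) * sin (p * t) - 0) <= M * t ^ 2.
Proof.
  set (A := Rabs a * exp (Rabs a)). exists (A * Rabs p). intros t Ht.
  rewrite Rminus_0_r, Rabs_mult.
  replace (A * Rabs p * t ^ 2) with ((A * t) * (Rabs p * t)) by ring.
  apply Rmult_le_compat; try apply Rabs_pos.
  - eapply Rle_trans; [apply sinh_Rabs_le|].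
    rewrite Rabs_mult, (Rabs_pos_eq t) by lra. unfold A. pose proof (Rabs_pos a) as Ha.
    pose proof (exp_le_compat (Rabs a * t) (Rabs a) ltac:(nra)) as He.
    assert (0 <= Rabs a * t) by nra. nra.
  - eapply Rle_trans; [apply sin_Rabs_le|].
    rewrite Rabs_mult, (Rabs_pos_eq t) by lra. lra.
Qed.

(** With [y = PI t / 2], [sin (2y) = 2 sin y cos y >= 2 y cos^2 y = y (1 + cos (2y)) >= y], and
    [y >= t] because [PI / 2 > 1]. *)
Lemma sin_PI_ge (t : R) : 0 <= t <= 1 / 2 -> t <= sin (PI * t).
Proof.
  intros Ht. pose proof PI_RGT_0 as Hpi. pose proof PI2_1 as Hpi2.
  set (y := PI * t / 2). assert (Hy : 0 <= y <= PI / 4) by (unfold y; split; nra).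
  replace (PI * t) with (2 * y) by (unfold y; field). rewrite sin_2a.
  assert (Hcos : 0 <= cos (2 * y)) by (apply cos_ge_0; lra).
  rewrite cos_2a_cos in Hcos.
  assert (Hcy : 0 <= cos y) by (apply cos_ge_0; lra).
  assert (Hs : y * cos y <= sin y).
  { destruct (Rle_lt_or_eq_dec 0 y (proj1 Hy)) as [Hlt| <-]; [|rewrite sin_0; lra].
    (* With the zero function in the role of [g], the increment lemma states that [z cos z - sin z]
       does not increase. *)
    pose proof (Rabs_increment_le (fun _ => 0) (fun z => z * cos z - sin z) (fun _ => 0)
      (fun z => - (z * sin z)) 0 y (proj1 Hy)) as H.
    cbv beta in H. rewrite Rminus_0_r, Rabs_R0, sin_0 in H.
    assert (0 <= 0 * cos 0 - 0 - (y * cos y - sin y)); [|lra].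
    apply H.
    - intros x _. apply (is_derive_const (V := R_NormedModule)).
    - intros x _. auto_derive; [trivial | ring].
    - intros x Hx. rewrite Ropp_involutive. apply Rmult_le_pos; [lra|].
      apply sin_ge_0; lra. }
  unfold y in *. nra.
Qed.

(** The poles of [1 / cosh (w / 2)] are [+-i odd_pi k]; the same numbers are the exponents in [1 /
    cosh (PI v) = 2 sum_k (-1)^k exp (- odd_pi k v)]. *)
Definition odd_pi (k : nat) : R := (2 * INR k + 1) * PI.

Lemma odd_pi_ge (k : nat) : PI <= odd_pi k.
Proof. unfold odd_pi. pose proof (pos_INR k). pose proof PI_RGT_0. nra. Qed.

Lemma cos_odd_half_pi (k : nat) : cos (odd_pi k / 2) = 0 /\ sin (odd_pi k / 2) = (-1) ^ k.
Proof.
  induction k as [|k [IHc IHs]].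
  - unfold odd_pi. simpl INR. replace ((2 * 0 + 1) * PI / 2) with (PI / 2) by field.
    rewrite cos_PI2, sin_PI2. split; reflexivity.
  - replace (odd_pi (S k) / 2) with (odd_pi k / 2 + PI)
      by (unfold odd_pi; rewrite S_INR; field).
    rewrite neg_cos, neg_sin, IHc, IHs. simpl. split; ring.
Qed.

Lemma sum_cos_odd (t : R) (n : nat) :
  2 * sin (PI * t) * sum_n (fun k => cos (odd_pi k * t)) n = sin (2 * INR (S n) * (PI * t)).
Proof.
  induction n as [|n IH].
  - rewrite sum_O. unfold odd_pi. simpl INR.
    replace ((2 * 0 + 1) * PI * t) with (PI * t) by ring.
    replace (2 * 1 * (PI * t)) with (2 * (PI * t)) by ring. rewrite sin_2a. ring.
  - rewrite sum_Sn_R, Rmult_plus_distr_l, IH, (S_INR (S n)).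
    replace (odd_pi (S n) * t) with (2 * INR (S n) * (PI * t) + PI * t)
      by (unfold odd_pi; ring).
    replace (2 * (INR (S n) + 1) * (PI * t)) with ((2 * INR (S n) * (PI * t) + PI * t) + PI * t) by ring.
    set (u := 2 * INR (S n) * (PI * t) + PI * t).
    replace (2 * INR (S n) * (PI * t)) with (u - PI * t) by (unfold u; ring).
    rewrite sin_minus, sin_plus. ring.
Qed.

(* The Cesaro sums of the Dirichlet kernel [D_n = sum_{k <= n} cos ((2k+1) PI t)]. *)
Lemma sum_sum_cos_odd (t : R) (m : nat) :
  2 * sin (PI * t) ^ 2 * sum_n (fun n => sum_n (fun k => cos (odd_pi k * t)) n) m =
  sin (INR (S m) * (PI * t)) * sin (INR (S (S m)) * (PI * t)).
Proof.
  induction m as [|m IH].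
  - rewrite !sum_O. unfold odd_pi. simpl INR.
    replace ((2 * 0 + 1) * PI * t) with (PI * t) by ring.
    replace ((1 + 1) * (PI * t)) with (2 * (PI * t)) by ring.
    rewrite Rmult_1_l, sin_2a. ring.
  - rewrite sum_Sn_R, Rmult_plus_distr_l, IH.
    pose proof (sum_cos_odd t (S m)) as H.
    replace (2 * sin (PI * t) ^ 2 * sum_n (fun k => cos (odd_pi k * t)) (S m))
      with (sin (PI * t) * (2 * sin (PI * t) * sum_n (fun k => cos (odd_pi k * t)) (S m))) by ring.
    rewrite H. rewrite (S_INR (S (S m))), (S_INR (S m)).
    set (w := (INR (S m) + 1) * (PI * t)).
    replace (2 * (INR (S m) + 1) * (PI * t)) with (2 * w) by (unfold w; ring).
    replace (INR (S m) * (PI * t)) with (w - PI * t) by (unfold w; ring).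
    replace ((INR (S m) + 1 + 1) * (PI * t)) with (w + PI * t) by (unfold w; ring).
    rewrite sin_2a, sin_minus, sin_plus. ring.
Qed.

Definition cesaro (u : nat -> R) (m : nat) : R := sum_n u m / INR (S m).

Lemma cesaro_ext (u w : nat -> R) (m : nat) :
  (forall n, u n = w n) -> cesaro u m = cesaro w m.
Proof. intros H. unfold cesaro. f_equal. now apply sum_n_ext. Qed.

Lemma cesaro_lin (p q : R) (u w : nat -> R) (m : nat) :
  cesaro (fun n => p * u n + q * w n) m = p * cesaro u m + q * cesaro w m.
Proof.
  assert (H : sum_n (fun n => p * u n + q * w n) m = p * sum_n u m + q * sum_n w m :> R).
  { induction m as [|m IH]; [now rewrite !sum_O|]. rewrite !sum_Sn_R, IH. ring. }
  unfold cesaro. rewrite H. field. apply not_0_INR; lia.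
Qed.

Lemma filterlim_cesaro (u : nat -> R) (l : R) :
  filterlim u eventually (locally l) -> filterlim (cesaro u) eventually (locally l).
Proof.
  intros Hu. apply is_lim_seq_Reals in Hu. apply Cesaro_1 in Hu. apply is_lim_seq_Reals in Hu.
  apply (is_lim_seq_incr_1 _ l) in Hu.
  apply filterlim_ext with (2 := Hu). intros m. unfold cesaro. now rewrite sum_n_Reals.
Qed.

Lemma is_RInt_sum_n (f : nat -> R -> R) (I : nat -> R) (a b : R) (n : nat) :
  (forall k, is_RInt (f k) a b (I k)) ->
  is_RInt (fun x => sum_n (fun k => f k x) n) a b (sum_n I n).
Proof.
  intros H. induction n as [|n IH].
  - rewrite sum_O. apply is_RInt_ext with (2 := H 0%nat). intros x _. now rewrite sum_O.
  - rewrite sum_Sn_R. apply is_RInt_ext with (fun x => sum_n (fun k => f k x) n + f (S n) x).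
    + intros x _. now rewrite sum_Sn_R.
    + apply (is_RInt_plus (V := R_NormedModule) (fun x => sum_n (fun k => f k x) n) (f (S n)));
        [exact IH | apply H].
Qed.

Lemma is_RInt_Rabs_le (f : R -> R) (a b I M : R) :
  a <= b -> is_RInt f a b I -> (forall x, a <= x <= b -> Rabs (f x) <= M) ->
  Rabs I <= (b - a) * M.
Proof.
  intros Hab HI HM. exact (norm_RInt_le_const (V := R_NormedModule) f a b I M Hab HM HI).
Qed.

(** Leibniz's series for [PI / 4], rescaled. The terms are the integrals of [2 cos (odd_pi k * t)]
    over [[0, 1/2]], so this is the Fourier expansion of a constant at [t = 0]. *)
Lemma leibniz_odd_pi :
  filterlim (fun n => sum_n (fun k => 2 * (-1) ^ k / odd_pi k) n) eventually (locally (1 / 2)).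
Proof.
  pose proof Alt_PI_eq as H. unfold Alt_PI in H. destruct exist_PI as [l Hl].
  apply is_lim_seq_Reals in Hl. pose proof PI_RGT_0 as Hpi.
  replace (1 / 2) with (2 / PI * l) by (rewrite <- H in *; field; lra).
  apply filterlim_ext with (fun n => 2 / PI * sum_f_R0 (tg_alt PI_tg) n).
  - intros n. rewrite <- sum_n_Reals. induction n as [|n IH].
    + rewrite !sum_O. unfold tg_alt, PI_tg, odd_pi. simpl. field. lra.
    + rewrite !sum_Sn_R, <- IH, Rmult_plus_distr_l. f_equal.
      unfold tg_alt, PI_tg, odd_pi. rewrite plus_INR, mult_INR. simpl (INR 2). simpl (INR 1).
      pose proof (pos_INR (S n)). field. split; lra.
  - apply filterlim_scal_R; [apply eventually_filter | exact Hl].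
Qed.

(** The constant [g0] is covered by Leibniz's series. For [g - g0], the sum of the first [m + 1]
    Dirichlet kernels is at most [1 / (2 t^2)], so its product with [2 (g - g0)] is bounded
    independently of [m], and the mean is [O(1 / m)]. *)
Lemma cesaro_fourier_zero (g : R -> R) (g0 M : R) (I : nat -> R) :
  (forall t, 0 <= t <= 1 / 2 -> Rabs (g t - g0) <= M * t ^ 2) ->
  (forall k, is_RInt (fun t => 2 * g t * cos (odd_pi k * t)) 0 (1 / 2) (I k)) ->
  filterlim (cesaro (sum_n I)) eventually (locally (g0 / 2)).
Proof.
  intros Hg HI.
  set (B := fun k => 2 * (-1) ^ k / odd_pi k).
  set (I' := fun k => I k - g0 * B k).
  assert (Hodd : forall k, 0 < odd_pi k) by (intros k; pose proof (odd_pi_ge k); pose proof PI_RGT_0; lra).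
  assert (HB : forall k, is_RInt (fun t => 2 * cos (odd_pi k * t)) 0 (1 / 2) (B k)).
  { intros k. specialize (Hodd k).
    replace (B k) with (2 * sin (odd_pi k * (1 / 2)) / odd_pi k - 2 * sin (odd_pi k * 0) / odd_pi k).
    - apply (is_RInt_antiderivative (fun t => 2 * sin (odd_pi k * t) / odd_pi k)).
      + intros t. auto_derive; [trivial|]. field. lra.
      + intros t. auto_derive. trivial.
    - replace (odd_pi k * (1 / 2)) with (odd_pi k / 2) by field.
      rewrite (proj2 (cos_odd_half_pi k)), Rmult_0_r, sin_0. unfold B. field. lra. }
  assert (HI' : forall k, is_RInt (fun t => 2 * (g t - g0) * cos (odd_pi k * t)) 0 (1 / 2) (I' k)).
  { intros k. apply is_RInt_ext with (fun t => minus (2 * g t * cos (odd_pi k * t)) (scal g0 (2 * cos (odd_pi k * t)))).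
    - intros t _. unfold minus, plus, opp, scal; simpl. unfold mult; simpl. ring.
    - apply (is_RInt_minus (V := R_NormedModule)); [apply HI|].
      apply (is_RInt_scal (V := R_NormedModule)), HB. }
  assert (Hces : forall m, Rabs (cesaro (sum_n I') m) <= Rabs M * / INR (S m)).
  { intros m. unfold cesaro, Rdiv. rewrite Rabs_mult.
    assert (HSm : 0 < / INR (S m)) by (apply Rinv_0_lt_compat, lt_0_INR; lia).
    rewrite (Rabs_pos_eq (/ INR (S m))) by lra.
    apply Rmult_le_compat_r; [lra|].
    pose proof (is_RInt_sum_n _ _ _ _ m (fun n => is_RInt_sum_n _ _ _ _ n HI')) as H.
    eapply Rle_trans; [apply (is_RInt_Rabs_le _ 0 (1 / 2) _ (Rabs M) ltac:(lra) H)|].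
    2: { pose proof (Rabs_pos M). lra. }
    intros t Ht.
    assert (Hfac : forall n, sum_n (fun k => 2 * (g t - g0) * cos (odd_pi k * t)) n =
      2 * (g t - g0) * sum_n (fun k => cos (odd_pi k * t)) n :> R).
    { intros n. induction n as [|n IH]; [now rewrite !sum_O|]. rewrite !sum_Sn_R, IH. ring. }
    erewrite sum_n_ext by (intros n; apply Hfac).
    assert (Hfac2 : forall u c, sum_n (fun n => c * u n) m = c * sum_n u m :> R).
    { intros u c. clear. induction m as [|m IH]; [now rewrite !sum_O|]. rewrite !sum_Sn_R, IH. ring. }
    rewrite Hfac2. pose proof (sum_sum_cos_odd t m) as Hs.
    set (D := sum_n (fun n => sum_n (fun k => cos (odd_pi k * t)) n) m) in *.
    specialize (Hg t Ht). pose proof (sin_PI_ge t Ht) as Hsin.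
    (* The bound on the kernel is kept as a product, so as to include [t = 0]. *)
    assert (HD : 2 * t ^ 2 * Rabs D <= 1).
    { apply Rle_trans with (2 * sin (PI * t) ^ 2 * Rabs D).
      - apply Rmult_le_compat_r; [apply Rabs_pos|].
        apply Rmult_le_compat_l; [lra|]. apply pow_incr. lra.
      - rewrite <- (Rabs_pos_eq (2 * sin (PI * t) ^ 2)) by (pose proof (pow2_ge_0 (sin (PI * t))); lra).
        rewrite <- Rabs_mult, Hs, Rabs_mult.
        replace 1 with (1 * 1) by ring.
        apply Rmult_le_compat; try apply Rabs_pos; apply Rabs_sin_le_1. }
    rewrite !Rabs_mult, (Rabs_pos_eq 2) by lra.
    pose proof (Rle_abs M). pose proof (Rabs_pos M). pose proof (Rabs_pos D).
    pose proof (pow2_ge_0 t).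
    apply Rle_trans with (2 * (Rabs M * t ^ 2) * Rabs D).
    - apply Rmult_le_compat_r; [lra|]. nra.
    - nra. }
  assert (H0 : filterlim (cesaro (sum_n I')) eventually (locally 0)).
  { apply filterlim_locally_R; [apply eventually_filter|]. intros eps He.
    destruct (nfloor_ex (Rabs M / eps)) as [n [_ Hn]].
    { apply Rmult_le_pos; [apply Rabs_pos | left; now apply Rinv_0_lt_compat]. }
    exists n. intros m Hm. rewrite Rminus_0_r. eapply Rle_lt_trans; [apply Hces|].
    assert (Hm' : Rabs M / eps < INR (S m)).
    { eapply Rlt_le_trans; [exact Hn|]. rewrite S_INR. apply le_INR in Hm. lra. }
    assert (HSm : 0 < INR (S m)) by (apply lt_0_INR; lia).
    apply (Rmult_lt_reg_r (INR (S m))); [exact HSm|].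
    rewrite Rmult_assoc, Rinv_l, Rmult_1_r by lra.
    apply (Rmult_lt_compat_l eps) in Hm'; [|exact He].
    replace (eps * (Rabs M / eps)) with (Rabs M) in Hm' by (field; lra). exact Hm'. }
  replace (g0 / 2) with (1 * 0 + g0 * (1 / 2)) by field.
  apply filterlim_ext with (fun m => 1 * cesaro (sum_n I') m + g0 * cesaro (sum_n B) m).
  - intros m. rewrite <- cesaro_lin. apply cesaro_ext. intros n.
    induction n as [|n IH]; [rewrite !sum_O; unfold I'; ring|].
    rewrite !sum_Sn_R, <- IH. unfold I'. ring.
  - apply filterlim_plus_R; [apply eventually_filter | |];
      (apply filterlim_scal_R; [apply eventually_filter|]); [exact H0|].
    apply filterlim_cesaro, leibniz_odd_pi.
Qed.

(** * Partial fractions of the hyperbolic secant *)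

(* [rho + i tau] is [2 c / (w^2 + c^2)] with [w = a - i p]. *)
Definition sech_rho (a p c : R) : R :=
  (c + p) / (a ^ 2 + (c + p) ^ 2) + (c - p) / (a ^ 2 + (c - p) ^ 2).
Definition sech_tau (a p c : R) : R :=
  a / (a ^ 2 + (c - p) ^ 2) - a / (a ^ 2 + (c + p) ^ 2).

Lemma odd_pi_denominator (a p : R) (k : nat) : Rabs p < PI ->
  0 < a ^ 2 + (odd_pi k - p) ^ 2 /\ 0 < a ^ 2 + (odd_pi k + p) ^ 2.
Proof.
  intros Hp. apply Rabs_def2 in Hp. pose proof (odd_pi_ge k).
  split; nra.
Qed.

Lemma cos_odd_pi_shift (p : R) (k : nat) :
  cos ((odd_pi k + p) * (1 / 2)) = - ((-1) ^ k * sin (p / 2)) /\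
  sin ((odd_pi k + p) * (1 / 2)) = (-1) ^ k * cos (p / 2) /\
  cos ((odd_pi k - p) * (1 / 2)) = (-1) ^ k * sin (p / 2) /\
  sin ((odd_pi k - p) * (1 / 2)) = (-1) ^ k * cos (p / 2).
Proof.
  destruct (cos_odd_half_pi k) as [Hc Hs].
  replace ((odd_pi k + p) * (1 / 2)) with (odd_pi k / 2 + p / 2) by field.
  replace ((odd_pi k - p) * (1 / 2)) with (odd_pi k / 2 - p / 2) by field.
  rewrite cos_plus, cos_minus, sin_plus, sin_minus, Hc, Hs. repeat split; ring.
Qed.

(** With [w = a - i p] and [c = odd_pi k], the integral of [2 cosh (w t) cos (c t)] over [[0, 1/2]]
    is [(-1)^k cosh (w / 2) * 2c / (w^2 + c^2)]. This is its real part; the companion with [sinh]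
    and [sin] is minus its imaginary part. *)
Lemma is_RInt_cosh_cos_odd (a p : R) (k : nat) : Rabs p < PI ->
  is_RInt (fun t => 2 * (cosh (a * t) * cos (p * t)) * cos (odd_pi k * t)) 0 (1 / 2)
    ((-1) ^ k * (cosh (a / 2) * cos (p / 2) * sech_rho a p (odd_pi k)
                 + sinh (a / 2) * sin (p / 2) * sech_tau a p (odd_pi k))).
Proof.
  intros Hp. destruct (odd_pi_denominator a p k Hp) as [Hm Hq].
  (* [F b] is an antiderivative of [cosh (a t) cos (b t)]; the product of two cosines is split into
     [b = c + p] and [b = c - p]. *)
  set (F := fun b t => (a * sinh (a * t) * cos (b * t) + b * cosh (a * t) * sin (b * t)) / (a ^ 2 + b ^ 2)).
  destruct (cos_odd_pi_shift p k) as (E1 & E2 & E3 & E4).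
  set (c := odd_pi k) in *.
  replace (_ * (_ + _)) with ((F (c + p) (1 / 2) + F (c - p) (1 / 2)) - (F (c + p) 0 + F (c - p) 0)).
  - apply (is_RInt_antiderivative (fun t => F (c + p) t + F (c - p) t)).
    + intros t. unfold F, cosh, sinh. auto_derive; [trivial|].
      replace (c * t) with (((c + p) * t + (c - p) * t) / 2) by field.
      replace (p * t) with (((c + p) * t - (c - p) * t) / 2) by field.
      set (u := (c + p) * t). set (w := (c - p) * t).
      assert (Hcc : 2 * cos ((u - w) / 2) * cos ((u + w) / 2) = cos u + cos w).
      { replace u with ((u + w) / 2 + (u - w) / 2) at 3 by field.
        replace w with ((u + w) / 2 - (u - w) / 2) at 5 by field.
        rewrite cos_plus, cos_minus. ring. }
      replace (2 * ((exp (a * t) + exp (- (a * t))) / 2 * cos ((u - w) / 2)) * cos ((u + w) / 2))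
        with ((exp (a * t) + exp (- (a * t))) / 2 * (2 * cos ((u - w) / 2) * cos ((u + w) / 2))) by ring.
      rewrite Hcc. field. lra.
    + intros t. unfold cosh. auto_derive. trivial.
  - unfold F, sech_rho, sech_tau. rewrite E1, E2, E3, E4, !Rmult_0_r, sin_0, cos_0, sinh_0.
    replace (a * (1 / 2)) with (a / 2) by field. field. lra.
Qed.

Lemma is_RInt_sinh_sin_odd (a p : R) (k : nat) : Rabs p < PI ->
  is_RInt (fun t => 2 * (sinh (a * t) * sin (p * t)) * cos (odd_pi k * t)) 0 (1 / 2)
    ((-1) ^ k * (sinh (a / 2) * sin (p / 2) * sech_rho a p (odd_pi k)
                 - cosh (a / 2) * cos (p / 2) * sech_tau a p (odd_pi k))).
Proof.
  intros Hp. destruct (odd_pi_denominator a p k Hp) as [Hm Hq].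
  set (F := fun b t => (a * cosh (a * t) * sin (b * t) - b * sinh (a * t) * cos (b * t)) / (a ^ 2 + b ^ 2)).
  destruct (cos_odd_pi_shift p k) as (E1 & E2 & E3 & E4).
  set (c := odd_pi k) in *.
  replace (_ * (_ - _)) with ((F (c + p) (1 / 2) - F (c - p) (1 / 2)) - (F (c + p) 0 - F (c - p) 0)).
  - apply (is_RInt_antiderivative (fun t => F (c + p) t - F (c - p) t)).
    + intros t. unfold F, cosh, sinh. auto_derive; [trivial|].
      replace (c * t) with (((c + p) * t + (c - p) * t) / 2) by field.
      replace (p * t) with (((c + p) * t - (c - p) * t) / 2) by field.
      set (u := (c + p) * t). set (w := (c - p) * t).
      assert (Hcc : 2 * sin ((u - w) / 2) * cos ((u + w) / 2) = sin u - sin w).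
      { replace u with ((u + w) / 2 + (u - w) / 2) at 3 by field.
        replace w with ((u + w) / 2 - (u - w) / 2) at 5 by field.
        rewrite sin_plus, sin_minus. ring. }
      replace (2 * ((exp (a * t) - exp (- (a * t))) / 2 * sin ((u - w) / 2)) * cos ((u + w) / 2))
        with ((exp (a * t) - exp (- (a * t))) / 2 * (2 * sin ((u - w) / 2) * cos ((u + w) / 2))) by ring.
      rewrite Hcc. field. lra.
    + intros t. unfold sinh. auto_derive. trivial.
  - unfold F, sech_rho, sech_tau. rewrite E1, E2, E3, E4, !Rmult_0_r, sin_0, cos_0, sinh_0.
    replace (a * (1 / 2)) with (a / 2) by field. field. lra.
Qed.

Lemma cosh_cos_denominator (a p : R) : Rabs p < PI ->
  0 < (cosh (a / 2) * cos (p / 2)) ^ 2 + (sinh (a / 2) * sin (p / 2)) ^ 2.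
Proof.
  intros Hp. apply Rabs_def2 in Hp.
  assert (0 < cos (p / 2)) by (apply cos_gt_0; lra).
  assert (0 < cosh (a / 2)).
  { unfold cosh. pose proof (exp_pos (a / 2)). pose proof (exp_pos (- (a / 2))). lra. }
  pose proof (pow2_ge_0 (sinh (a / 2) * sin (p / 2))).
  assert (0 < cosh (a / 2) * cos (p / 2)) by now apply Rmult_lt_0_compat.
  nra.
Qed.

(** This is [Im (1 / (2 cosh (w / 2)))] with [w = a - i p], and it will be the sine transform at [a]
    of [sinh (p v) / cosh (PI v)]. *)
Definition fourier_sinh_sech (a p : R) : R :=
  sinh (a / 2) * sin (p / 2) / 2 /
  ((cosh (a / 2) * cos (p / 2)) ^ 2 + (sinh (a / 2) * sin (p / 2)) ^ 2).

(* The partial fractions of [1 / cosh (w / 2)], [w = a - i p], summed by the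
   arithmetic mean: [cosh (w / 2)] times the series is the Fourier series of
   [cosh (w t)] at [t = 0]. *)
Lemma filterlim_cesaro_sech_tau (a p : R) : Rabs p < PI ->
  filterlim (cesaro (sum_n (fun k => (-1) ^ k * sech_tau a p (odd_pi k)))) eventually
    (locally (fourier_sinh_sech a p)).
Proof.
  intros Hp.
  destruct (cosh_cos_quadratic a p) as [M1 HM1]. destruct (sinh_sin_quadratic a p) as [M2 HM2].
  pose proof (cesaro_fourier_zero _ _ _ _ HM1 (fun k => is_RInt_cosh_cos_odd a p k Hp)) as H1.
  pose proof (cesaro_fourier_zero _ _ _ _ HM2 (fun k => is_RInt_sinh_sin_odd a p k Hp)) as H2.
  pose proof (cosh_cos_denominator a p Hp) as HD. unfold fourier_sinh_sech.
  set (c := cosh (a / 2) * cos (p / 2)) in *. set (s := sinh (a / 2) * sin (p / 2)) in *.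
  set (D := c ^ 2 + s ^ 2) in *.
  (* The two expansions form a linear system in [rho] and [tau]; this combination eliminates [rho].
     Their limits are [1 / 2] and [0 / 2], from the values 1 and 0 at the origin. *)
  replace (s / 2 / D) with (s / D * (1 / 2) + (- c / D) * (0 / 2)) by (field; lra).
  pose proof (filterlim_plus_R _ _ _ _ _ _ (filterlim_scal_R _ _ (s / D) _ _ H1)
    (filterlim_scal_R _ _ (- c / D) _ _ H2)) as H.
  apply filterlim_ext with (2 := H). intros m. cbv beta. rewrite <- cesaro_lin.
  apply cesaro_ext. intros n. clear H H1 H2. induction n as [|n IH].
  - rewrite !sum_O. unfold D. field. fold D. lra.
  - rewrite !sum_Sn_R, <- IH. unfold D. field. fold D. lra.
Qed.

(** * Elementary integrals and bounds for the transform *)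

Lemma is_lim_exp_neg (b : R) : 0 < b ->
  filterlim (fun x => exp (- b * x)) (Rbar_locally p_infty) (locally 0).
Proof.
  intros Hb. apply (is_lim_comp exp (fun x => - b * x) p_infty 0 m_infty).
  - apply is_lim_exp_m.
  - replace m_infty with (Rbar_mult (- b) p_infty).
    + apply is_lim_scal_l, is_lim_id.
    + apply is_Rbar_mult_unique. unfold is_Rbar_mult, Rbar_mult'. simpl.
      destruct (Rle_dec 0 (- b)); [exfalso; lra|reflexivity].
  - exists 0. intros; discriminate.
Qed.

Lemma filterlim_bounded_mult_0 (f g : R -> R) (M : R) (F : (R -> Prop) -> Prop) (FF : Filter F) :
  (forall x, Rabs (g x) <= M) -> filterlim f F (locally 0) ->
  filterlim (fun x => f x * g x) F (locally 0).
Proof.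
  intros Hg Hf. apply (filterlim_locally_R F FF). intros eps He.
  assert (HM : 0 <= M) by (eapply Rle_trans; [apply Rabs_pos | apply (Hg 0)]).
  pose proof (proj1 (filterlim_locally_R F FF _ _) Hf (eps / (M + 1))) as H.
  assert (He' : 0 < eps / (M + 1)) by (apply Rdiv_lt_0_compat; lra).
  generalize (H He'). apply filter_imp. intros x Hx.
  rewrite Rminus_0_r in *. rewrite Rabs_mult. specialize (Hg x).
  pose proof (Rabs_pos (f x)). pose proof (Rabs_pos (g x)).
  apply Rle_lt_trans with (Rabs (f x) * M); [now apply Rmult_le_compat_l|].
  apply Rle_lt_trans with (eps / (M + 1) * M); [apply Rmult_le_compat_r; lra|].
  replace eps with (eps / (M + 1) * (M + 1)) at 2 by (field; lra). nra.
Qed.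

Lemma is_RInt_sin_exp (a b x : R) : 0 < b ->
  is_RInt (fun v => sin (a * v) * exp (- b * v)) 0 x
    (a / (a ^ 2 + b ^ 2) - exp (- b * x) * ((b * sin (a * x) + a * cos (a * x)) / (a ^ 2 + b ^ 2))).
Proof.
  intros Hb. assert (HD : 0 < a ^ 2 + b ^ 2) by (pose proof (pow2_ge_0 a); nra).
  set (F := fun v => - exp (- b * v) * ((b * sin (a * v) + a * cos (a * v)) / (a ^ 2 + b ^ 2))).
  replace (_ - _) with (F x - F 0).
  - apply is_RInt_antiderivative.
    + intros v. unfold F. auto_derive; [trivial|]. field. lra.
    + intros v. auto_derive. trivial.
  - unfold F. rewrite !Rmult_0_r, exp_0, sin_0, cos_0. field. lra.
Qed.

Lemma filterlim_RInt_sin_exp (a b : R) : 0 < b ->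
  filterlim (fun x => RInt (fun v => sin (a * v) * exp (- b * v)) 0 x) (Rbar_locally p_infty)
    (locally (a / (a ^ 2 + b ^ 2))).
Proof.
  intros Hb. assert (HD : 0 < a ^ 2 + b ^ 2) by (pose proof (pow2_ge_0 a); nra).
  replace (a / (a ^ 2 + b ^ 2)) with (a / (a ^ 2 + b ^ 2) + (-1) * 0) by ring.
  apply filterlim_ext with (fun x => a / (a ^ 2 + b ^ 2) + (-1) *
    (exp (- b * x) * ((b * sin (a * x) + a * cos (a * x)) / (a ^ 2 + b ^ 2)))).
  { intros x. symmetry. rewrite (is_RInt_unique _ _ _ _ (is_RInt_sin_exp a b x Hb)). ring. }
  apply filterlim_plus_R; [apply Rbar_locally_filter | apply filterlim_const|].
  apply filterlim_scal_R; [apply Rbar_locally_filter|].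
  apply filterlim_bounded_mult_0 with ((b + Rabs a) / (a ^ 2 + b ^ 2));
    [apply Rbar_locally_filter | | now apply is_lim_exp_neg].
  intros x. unfold Rdiv. rewrite Rabs_mult, (Rabs_pos_eq (/ _)) by (left; now apply Rinv_0_lt_compat).
  apply Rmult_le_compat_r; [left; now apply Rinv_0_lt_compat|].
  eapply Rle_trans; [apply Rabs_triang|]. rewrite !Rabs_mult, (Rabs_pos_eq b) by lra.
  pose proof (Rabs_sin_le_1 (a * x)) as Hs. pose proof (Rabs_cos_le_1 (a * x)) as Hc.
  pose proof (Rabs_pos a). apply Rplus_le_compat; nra.
Qed.

Lemma cosh_ge_exp (y : R) : exp (Rabs y) <= 2 * cosh y.
Proof.
  unfold cosh. pose proof (exp_pos y). pose proof (exp_pos (- y)).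
  unfold Rabs. destruct (Rcase_abs y); lra.
Qed.

Lemma cosh_pos (y : R) : 0 < cosh y.
Proof. pose proof (cosh_ge_exp y). pose proof (exp_pos (Rabs y)). lra. Qed.

Definition sinh_sech (p v : R) : R := sinh (p * v) / cosh (PI * v).

Lemma sinh_sech_bound (p v : R) : 0 <= v ->
  Rabs (sinh_sech p v) <= exp (- (PI - Rabs p) * v).
Proof.
  intros Hv. unfold sinh_sech, Rdiv. rewrite Rabs_mult, (Rabs_pos_eq (/ _)).
  2: { left. apply Rinv_0_lt_compat, cosh_pos. }
  apply (Rmult_le_reg_r (cosh (PI * v))); [apply cosh_pos|].
  rewrite Rmult_assoc, Rinv_l, Rmult_1_r by (pose proof (cosh_pos (PI * v)); lra).
  assert (H1 : Rabs (sinh (p * v)) <= exp (Rabs p * v) / 2).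
  { unfold sinh. assert (Habs : Rabs p * v = Rabs (p * v)) by (rewrite Rabs_mult, (Rabs_pos_eq v); lra).
    rewrite Habs. pose proof (exp_pos (p * v)). pose proof (exp_pos (- (p * v))).
    unfold Rabs at 2. destruct (Rcase_abs (p * v)) as [Hn|Hn].
    - pose proof (exp_le_compat (p * v) (- (p * v)) ltac:(lra)). apply Rabs_le; lra.
    - pose proof (exp_le_compat (- (p * v)) (p * v) ltac:(lra)). apply Rabs_le; lra. }
  pose proof (cosh_ge_exp (PI * v)) as H2. pose proof PI_RGT_0 as Hpi.
  rewrite Rabs_mult, (Rabs_pos_eq PI), (Rabs_pos_eq v) in H2 by lra.
  eapply Rle_trans; [exact H1|].
  replace (Rabs p * v) with (- (PI - Rabs p) * v + PI * v) by ring. rewrite exp_plus.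
  pose proof (exp_pos (- (PI - Rabs p) * v)). nra.
Qed.

(** Multiplied by [cosh (PI v)], the sum telescopes. The exact remainder is kept: it has absolute
    value 1 at [v = 0], so convergence is not uniform there, but its integral is small. *)
Lemma sech_geometric (v : R) (n : nat) :
  / cosh (PI * v) - sum_n (fun k => 2 * (-1) ^ k * exp (- odd_pi k * v)) n =
  - (-1) ^ n * exp (- (2 * INR (S n) * PI) * v) / cosh (PI * v).
Proof.
  pose proof (cosh_pos (PI * v)) as Hc.
  assert (Hstep : forall n, 2 * exp (- odd_pi n * v) * cosh (PI * v)
     = exp (- (2 * INR n * PI) * v) + exp (- (2 * INR (S n) * PI) * v)).
  { intros k. unfold cosh, odd_pi. rewrite S_INR.
    replace (- (2 * INR k * PI) * v) with (- ((2 * INR k + 1) * PI) * v + PI * v) by ring.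
    replace (- (2 * (INR k + 1) * PI) * v) with (- ((2 * INR k + 1) * PI) * v + - (PI * v)) by ring.
    rewrite !exp_plus. field. }
  apply (Rmult_eq_reg_r (cosh (PI * v))); [|lra].
  replace (- (-1) ^ n * exp (- (2 * INR (S n) * PI) * v) / cosh (PI * v) * cosh (PI * v))
    with (- (-1) ^ n * exp (- (2 * INR (S n) * PI) * v)) by (field; lra).
  rewrite Rmult_minus_distr_r, Rinv_l by lra.
  induction n as [|n IH].
  - specialize (Hstep 0%nat). rewrite sum_O. simpl pow.
    assert (E : exp (- (2 * INR 0 * PI) * v) = 1).
    { rewrite <- exp_0. f_equal. simpl. ring. }
    rewrite E in Hstep. lra.
  - specialize (Hstep (S n)). rewrite sum_Sn_R. simpl pow.
    assert (Hm : (-1) ^ n * (2 * exp (- odd_pi (S n) * v) * cosh (PI * v)) =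
      (-1) ^ n * (exp (- (2 * INR (S n) * PI) * v) + exp (- (2 * INR (S (S n)) * PI) * v)))
      by (now rewrite Hstep).
    lra.
Qed.

(** * Termwise integration *)

Lemma ex_derive_sinh_sech (p v : R) : ex_derive (sinh_sech p) v.
Proof.
  unfold sinh_sech, sinh, cosh. auto_derive.
  pose proof (exp_pos (PI * v)). pose proof (exp_pos (- (PI * v))). lra.
Qed.

Lemma ex_RInt_ex_derive (f : R -> R) (a b : R) : (forall x, ex_derive f x) -> ex_RInt f a b.
Proof.
  intros H. apply (ex_RInt_continuous (V := R_CompleteNormedModule)).
  intros x _. apply (ex_derive_continuous (V := R_NormedModule)), H.
Qed.

Lemma ex_RInt_sin_sinh_sech (a p x : R) :
  ex_RInt (fun v => sin (a * v) * sinh_sech p v) 0 x.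
Proof.
  apply ex_RInt_ex_derive. intros v. apply ex_derive_mult.
  - auto_derive. trivial.
  - apply ex_derive_sinh_sech.
Qed.

Lemma cesaro_const (x : R) (m : nat) : cesaro (fun _ => x) m = x.
Proof.
  unfold cesaro. rewrite sum_n_const. field. apply not_0_INR. lia.
Qed.

Lemma cesaro_dist (u e : nat -> R) (x : R) (m : nat) :
  (forall n, Rabs (x - u n) <= e n) -> Rabs (x - cesaro u m) <= cesaro e m.
Proof.
  intros H. rewrite <- (cesaro_const x m) at 1.
  replace (cesaro (fun _ => x) m - cesaro u m) with (1 * cesaro (fun _ => x) m + (-1) * cesaro u m) by ring.
  rewrite <- cesaro_lin. unfold cesaro, Rdiv. rewrite Rabs_mult.
  assert (Hm : 0 < / INR (S m)) by (apply Rinv_0_lt_compat, lt_0_INR; lia).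
  rewrite (Rabs_pos_eq (/ _)) by lra. apply Rmult_le_compat_r; [lra|].
  eapply Rle_trans; [apply (norm_sum_n_m (fun n => 1 * x + -1 * u n) 0 m)|].
  apply sum_n_m_le. intros n. replace (1 * x + -1 * u n) with (x - u n) by ring. apply H.
Qed.

Lemma RInt_exp_neg_le (b x : R) : 0 < b -> 0 <= x ->
  exists I, is_RInt (fun v => exp (- b * v)) 0 x I /\ I <= / b.
Proof.
  intros Hb Hx. exists (- exp (- b * x) / b - - exp (- b * 0) / b). split.
  - apply (is_RInt_antiderivative (fun v => - exp (- b * v) / b)).
    + intros v. auto_derive; [trivial|]. field. lra.
    + intros v. auto_derive. trivial.
  - rewrite Rmult_0_r, exp_0. pose proof (exp_pos (- b * x)).
    assert (0 < / b) by now apply Rinv_0_lt_compat. unfold Rdiv. nra.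
Qed.

(** The error integrand is at most [exp (- b v)] with [b = 2 (n + 1) PI], hence its integral at most
    [1 / b]. The bound does not depend on [x], which permits exchanging [x -> oo] with the
    summation. *)
Lemma RInt_sin_sinh_sech_partial (a p x : R) (n : nat) : Rabs p < PI -> 0 <= x ->
  Rabs (RInt (fun v => sin (a * v) * sinh_sech p v) 0 x -
    sum_n (fun k => (-1) ^ k *
      (RInt (fun v => sin (a * v) * exp (- (odd_pi k - p) * v)) 0 x
       - RInt (fun v => sin (a * v) * exp (- (odd_pi k + p) * v)) 0 x)) n) <= / INR (S n).
Proof.
  intros Hp Hx.
  assert (HE : forall b, ex_RInt (fun v => sin (a * v) * exp (- b * v)) 0 x).
  { intros b. apply ex_RInt_ex_derive. intros v. auto_derive. trivial. }
  assert (HS : is_RInt (fun v => sum_n (fun k => (-1) ^ k *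
      (sin (a * v) * exp (- (odd_pi k - p) * v) - sin (a * v) * exp (- (odd_pi k + p) * v))) n) 0 x
    (sum_n (fun k => (-1) ^ k *
      (RInt (fun v => sin (a * v) * exp (- (odd_pi k - p) * v)) 0 x
       - RInt (fun v => sin (a * v) * exp (- (odd_pi k + p) * v)) 0 x)) n)).
  { apply is_RInt_sum_n. intros k.
    apply (is_RInt_scal (V := R_NormedModule)
      (fun v => sin (a * v) * exp (- (odd_pi k - p) * v)
                - sin (a * v) * exp (- (odd_pi k + p) * v))).
    apply (is_RInt_minus (V := R_NormedModule)); apply (RInt_correct (V := R_CompleteNormedModule)), HE. }
  pose proof (is_RInt_minus (V := R_NormedModule) _ _ _ _ _ _
    (RInt_correct (V := R_CompleteNormedModule) _ _ _ (ex_RInt_sin_sinh_sech a p x)) HS) as HD.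
  set (b := 2 * INR (S n) * PI).
  assert (HSn : 0 < INR (S n)) by (apply lt_0_INR; lia).
  pose proof PI_RGT_0 as Hpi. pose proof PI2_1 as Hpi2.
  assert (Hb : 0 < b) by (unfold b; nra).
  destruct (RInt_exp_neg_le b x Hb Hx) as [I [HI HIb]].
  apply Rle_trans with I.
  - apply (norm_RInt_le (V := R_NormedModule) _ (fun v => exp (- b * v)) 0 x _ I Hx) with (2 := HD) (3 := HI).
    intros v Hv.
    assert (Hf : sum_n (fun k => (-1) ^ k *
      (sin (a * v) * exp (- (odd_pi k - p) * v) - sin (a * v) * exp (- (odd_pi k + p) * v))) n
      = sin (a * v) * sinh (p * v) * sum_n (fun k => 2 * (-1) ^ k * exp (- odd_pi k * v)) n :> R).
    { assert (Hk : forall k, (-1) ^ k *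
       (sin (a * v) * exp (- (odd_pi k - p) * v) - sin (a * v) * exp (- (odd_pi k + p) * v))
       = sin (a * v) * sinh (p * v) * (2 * (-1) ^ k * exp (- odd_pi k * v))).
      { intros k. unfold sinh.
        replace (- (odd_pi k - p) * v) with (- odd_pi k * v + p * v) by ring.
        replace (- (odd_pi k + p) * v) with (- odd_pi k * v + - (p * v)) by ring.
        rewrite !exp_plus. field. }
      clear -Hk. induction n as [|n IH]; [rewrite !sum_O; apply Hk|].
      rewrite !sum_Sn_R, IH, Hk. ring. }
    change (Rabs (sin (a * v) * sinh_sech p v - sum_n (fun k => (-1) ^ k *
      (sin (a * v) * exp (- (odd_pi k - p) * v) - sin (a * v) * exp (- (odd_pi k + p) * v))) n) <= exp (- b * v)).
    rewrite Hf.
    replace (sin (a * v) * sinh_sech p v - _)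
      with (sin (a * v) * sinh (p * v) *
        (/ cosh (PI * v) - sum_n (fun k => 2 * (-1) ^ k * exp (- odd_pi k * v)) n))
      by (unfold sinh_sech; field; apply Rgt_not_eq, cosh_pos).
    rewrite sech_geometric. fold b.
    replace (sin (a * v) * sinh (p * v) * (- (-1) ^ n * exp (- b * v) / cosh (PI * v)))
      with (- (sin (a * v) * sinh_sech p v * (-1) ^ n) * exp (- b * v))
      by (unfold sinh_sech; field; apply Rgt_not_eq, cosh_pos).
    rewrite Rabs_mult, (Rabs_pos_eq (exp _)) by (left; apply exp_pos).
    rewrite <- (Rmult_1_l (exp _)) at 2. apply Rmult_le_compat_r; [left; apply exp_pos|].
    rewrite Rabs_Ropp, !Rabs_mult, pow_1_abs, Rmult_1_r.
    replace 1 with (1 * 1) by ring.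
    apply Rmult_le_compat; try apply Rabs_pos; [apply Rabs_sin_le_1|].
    eapply Rle_trans; [apply sinh_sech_bound; lra|]. rewrite <- exp_0. apply exp_le_compat. nra.
  - eapply Rle_trans; [exact HIb|]. apply Rinv_le_contravar; [exact HSn|]. unfold b. nra.
Qed.

Lemma filterlim_inv_INR_S : filterlim (fun n => / INR (S n)) eventually (locally 0).
Proof.
  apply (is_lim_seq_incr_1 (fun n => / INR n) 0).
  apply (is_lim_seq_inv INR p_infty); [apply is_lim_seq_INR | discriminate].
Qed.

(** The sum of the partial fractions is known as a limit of means, so the integral over [[0, x]] is
    compared with means too; their error is the mean of [1 / (n + 1)]. An [m] is fixed first, then
    [x] tends to infinity. *)
Lemma filterlim_RInt_sin_sinh_sech (a p : R) : Rabs p < PI ->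
  filterlim (fun x => RInt (fun v => sin (a * v) * sinh_sech p v) 0 x) (Rbar_locally p_infty)
    (locally (fourier_sinh_sech a p)).
Proof.
  intros Hp. apply filterlim_locally_R; [apply Rbar_locally_filter|]. intros eps He.
  set (U := fun x k => (-1) ^ k *
      (RInt (fun v => sin (a * v) * exp (- (odd_pi k - p) * v)) 0 x
       - RInt (fun v => sin (a * v) * exp (- (odd_pi k + p) * v)) 0 x)).
  set (T := fun k => (-1) ^ k * sech_tau a p (odd_pi k)).
  assert (HU : forall m, filterlim (fun x => cesaro (sum_n (U x)) m) (Rbar_locally p_infty)
     (locally (cesaro (sum_n T) m))).
  { intros m. unfold cesaro, Rdiv. rewrite Rmult_comm.
    apply filterlim_ext with (fun x => / INR (S m) * sum_n (fun n => sum_n (U x) n) m).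
    { intros x. apply Rmult_comm. }
    apply filterlim_scal_R; [apply Rbar_locally_filter|].
    apply (filterlim_sum_n _ _ (fun n x => sum_n (U x) n)). intros n.
    apply (filterlim_sum_n _ _ (fun k x => U x k)). intros k.
    apply filterlim_scal_R; [apply Rbar_locally_filter|].
    apply Rabs_def2 in Hp. pose proof (odd_pi_ge k).
    unfold sech_tau.
    replace (a / (a ^ 2 + (odd_pi k - p) ^ 2) - a / (a ^ 2 + (odd_pi k + p) ^ 2))
      with (a / (a ^ 2 + (odd_pi k - p) ^ 2) + (-1) * (a / (a ^ 2 + (odd_pi k + p) ^ 2))) by ring.
    apply filterlim_ext with (fun x => RInt (fun v => sin (a * v) * exp (- (odd_pi k - p) * v)) 0 x
       + (-1) * RInt (fun v => sin (a * v) * exp (- (odd_pi k + p) * v)) 0 x); [intros x; ring|].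
    apply filterlim_plus_R; [apply Rbar_locally_filter | |
      apply filterlim_scal_R; [apply Rbar_locally_filter|]]; apply filterlim_RInt_sin_exp; lra. }
  pose proof (proj1 (filterlim_locally_R _ _ _ _) (filterlim_cesaro_sech_tau a p Hp) (eps / 3) ltac:(lra)) as H1.
  pose proof (proj1 (filterlim_locally_R _ _ _ _) (filterlim_cesaro _ _ filterlim_inv_INR_S)
    (eps / 3) ltac:(lra)) as H2.
  destruct (filter_ex _ (filter_and _ _ H1 H2)) as [m [H3 H4]].
  pose proof (proj1 (filterlim_locally_R _ _ _ _) (HU m) (eps / 3) ltac:(lra)) as H5.
  assert (H6 : Rbar_locally p_infty (fun x => 0 < x)) by (exists 0; auto).
  generalize (filter_and _ _ H5 H6). apply filter_imp. intros x [H7 Hx].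
  pose proof (cesaro_dist (sum_n (U x)) _ _ m
    (fun n => RInt_sin_sinh_sech_partial a p x n Hp (Rlt_le _ _ Hx))) as H8.
  fold T in H3. rewrite Rminus_0_r in H4. apply Rabs_def2 in H3. apply Rabs_def2 in H4.
  apply Rabs_def2 in H7. apply Rabs_le_between in H8. apply Rabs_def1; lra.
Qed.

(** * The integral of a single power *)

(** The denominator is [|1 + x e^(ip)|^2]; for [x > 0] it vanishes only if [x = 1] and
    [cos p = -1]. *)
Definition mellin_kernel (p x : R) : R :=
  (1 - x) * sin (p / 2) / (1 + 2 * x * cos p + x ^ 2).

(** With [e = sqrt x], [cosh (ln x / 2)] and [sinh (ln x / 2)] are [(e +- 1/e) / 2], and the
    denominator becomes [(1 + 2 x cos p + x^2) / (4 x)]. *)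
Lemma fourier_sinh_sech_ln (p x : R) : Rabs p < PI -> 0 < x ->
  - exp (- (1 / 2) * ln x) * fourier_sinh_sech (ln x) p = mellin_kernel p x.
Proof.
  intros Hp Hx. pose proof (cosh_cos_denominator (ln x) p Hp) as HD.
  unfold fourier_sinh_sech, mellin_kernel. unfold cosh, sinh in *.
  set (e := exp (ln x / 2)) in *.
  assert (He : 0 < e) by apply exp_pos.
  assert (Hx2 : x = e ^ 2).
  { unfold e. rewrite <- (exp_ln x Hx) at 1. simpl. rewrite Rmult_1_r, <- exp_plus. f_equal. field. }
  assert (Hi : exp (- (ln x / 2)) = / e) by (unfold e; apply exp_Ropp).
  replace (- (1 / 2) * ln x) with (- (ln x / 2)) by field. rewrite Hi in *.
  assert (Hc : cos p = 1 - 2 * sin (p / 2) ^ 2).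
  { replace p with (2 * (p / 2)) at 1 by field. rewrite cos_2a_sin. ring. }
  assert (Hcs : cos (p / 2) ^ 2 = 1 - sin (p / 2) ^ 2).
  { pose proof (sin2_cos2 (p / 2)) as H. unfold Rsqr in H. lra. }
  assert (HDe : ((e + / e) / 2 * cos (p / 2)) ^ 2 + ((e - / e) / 2 * sin (p / 2)) ^ 2
    = (1 + 2 * x * cos p + x ^ 2) / (4 * e ^ 2)).
  { rewrite Hc, Hx2. replace (((e + / e) / 2 * cos (p / 2)) ^ 2)
      with (((e + / e) / 2) ^ 2 * cos (p / 2) ^ 2) by ring.
    rewrite Hcs. field. lra. }
  rewrite HDe in *.
  assert (HDx : 0 < 1 + 2 * x * cos p + x ^ 2).
  { apply Rmult_lt_reg_r with (/ (4 * e ^ 2)).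
    - apply Rinv_0_lt_compat. pose proof (pow2_gt_0 e ltac:(lra)). lra.
    - rewrite Rmult_0_l. exact HD. }
  set (D := 1 + 2 * x * cos p + x ^ 2) in *. rewrite Hx2. field. lra.
Qed.

Lemma is_RInt_gen_0_infty (f : R -> R) (l : R) :
  (forall b, 0 < b -> ex_RInt f 0 b) ->
  filterlim (fun b => RInt f 0 b) (Rbar_locally p_infty) (locally l) ->
  is_RInt_gen f (at_point 0) (Rbar_locally p_infty) l.
Proof.
  intros Hf Hl P HP. specialize (Hl P HP). unfold filtermap in Hl.
  assert (H0 : Rbar_locally p_infty (fun b => 0 < b)) by (exists 0; auto).
  apply Filter_prod with (Q := fun a => a = 0) (R := fun b => 0 < b /\ P (RInt f 0 b)).
  - reflexivity.
  - now apply filter_and.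
  - intros a b -> [Hb HPb]. exists (RInt f 0 b). split; [|exact HPb].
    apply (RInt_correct (V := R_CompleteNormedModule)), Hf, Hb.
Qed.

Lemma filterlim_RInt_im_pow (p x : R) : Rabs p < PI -> 0 < x ->
  filterlim (fun b => RInt (fun v => im_pow (1 / 2) v x * sinh_sech p v) 0 b)
    (Rbar_locally p_infty) (locally (mellin_kernel p x)).
Proof.
  intros Hp Hx. rewrite <- fourier_sinh_sech_ln by assumption.
  apply filterlim_ext with (fun b => - exp (- (1 / 2) * ln x) *
    RInt (fun v => sin (ln x * v) * sinh_sech p v) 0 b).
  - intros b. symmetry. apply is_RInt_unique.
    apply is_RInt_ext with (fun v => scal (- exp (- (1 / 2) * ln x)) (sin (ln x * v) * sinh_sech p v)).
    + intros v _. unfold im_pow, scal; simpl; unfold mult; simpl. rewrite (Rmult_comm (ln x) v). ring.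
    + apply (is_RInt_scal (V := R_NormedModule)).
      apply (RInt_correct (V := R_CompleteNormedModule)), ex_RInt_sin_sinh_sech.
  - apply filterlim_scal_R; [apply Rbar_locally_filter|]. now apply filterlim_RInt_sin_sinh_sech.
Qed.

Lemma ex_RInt_im_pow (p x b : R) : ex_RInt (fun v => im_pow (1 / 2) v x * sinh_sech p v) 0 b.
Proof.
  apply ex_RInt_ex_derive. intros v. apply ex_derive_mult; [|apply ex_derive_sinh_sech].
  unfold im_pow. auto_derive. trivial.
Qed.

Lemma is_RInt_diff2_im_pow (p b : R) (k : nat) :
  is_RInt (fun v => diff2 (im_pow (1 / 2) v) k * sinh_sech p v) 0 b
    (diff2 (fun x => RInt (fun v => im_pow (1 / 2) v x * sinh_sech p v) 0 b) k).
Proof.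
  assert (H : forall x, is_RInt (fun v => im_pow (1 / 2) v x * sinh_sech p v) 0 b
    (RInt (fun v => im_pow (1 / 2) v x * sinh_sech p v) 0 b)).
  { intros x. apply (RInt_correct (V := R_CompleteNormedModule)), ex_RInt_im_pow. }
  pose proof (is_RInt_minus (V := R_NormedModule) _ _ _ _ _ _
    (is_RInt_minus (V := R_NormedModule) _ _ _ _ _ _
      (is_RInt_scal (V := R_NormedModule) _ _ _ 2 _ (H (2 * INR k + 1)))
      (H (2 * INR k + 1 / 2))) (H (2 * INR k + 3 / 2))) as HD.
  apply is_RInt_ext with (2 := HD). intros v _. unfold diff2, minus, plus, opp, scal; simpl.
  unfold mult; simpl. ring.
Qed.

(** * Exchange of sum and integral *)

(** Index 0, which involves the point [1/2], is bounded crudely term by term; the other indices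
    telescope in [x^(-1/2)]. *)
Definition diff2_majorant (k : nat) : R :=
  match k with
  | O => 2 * exp (- (1 / 2) * ln (2 * INR 0 + 1)) + exp (- (1 / 2) * ln (2 * INR 0 + 1 / 2))
         + exp (- (1 / 2) * ln (2 * INR 0 + 3 / 2))
  | S k => exp (- (1 / 2) * ln (2 * INR (S k) + 1 / 2))
           - exp (- (1 / 2) * ln (2 * INR (S (S k)) + 1 / 2))
  end.

Lemma ex_series_diff2_majorant : ex_series diff2_majorant.
Proof.
  apply ex_series_incr_1.
  destruct (ex_series_exp_ln_telescope (1 / 2) 1 ltac:(lra) ltac:(lra)) as [l Hl].
  exists l. apply is_series_ext_R with (2 := Hl). intros k. unfold diff2_majorant. ring.
Qed.

(** The factor is [(s + v) / s] at [s = 1/2]; being only linear in [v], it is harmless against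
    exponential decay. *)
Lemma diff2_im_pow_bound (v : R) (k : nat) : 0 <= v ->
  Rabs (diff2 (im_pow (1 / 2) v) k) <= (1 + 2 * v) * diff2_majorant k.
Proof.
  intros Hv. destruct k as [|k].
  - unfold diff2_majorant, diff2.
    assert (H : forall x, Rabs (im_pow (1 / 2) v x) <= exp (- (1 / 2) * ln x)).
    { intros x. unfold im_pow. rewrite Rabs_mult, Rabs_Ropp.
      pose proof (exp_pos (- (1 / 2) * ln x)). rewrite (Rabs_pos_eq (exp _)) by lra.
      pose proof (Rabs_sin_le_1 (v * ln x)). nra. }
    pose proof (H (2 * INR 0 + 1)) as H1. pose proof (H (2 * INR 0 + 1 / 2)) as H2.
    pose proof (H (2 * INR 0 + 3 / 2)) as H3. set (A := exp _) in *. set (B := exp _) in *.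
    apply Rabs_le_between in H1. apply Rabs_le_between in H2. apply Rabs_le_between in H3.
    apply Rabs_le. nra.
  - replace ((1 + 2 * v) * diff2_majorant (S k)) with ((1 / 2 + v) / (1 / 2) * diff2_majorant (S k)) by field.
    apply (diff2_pow_trig_bound _ _ v (1 / 2) k unit_bounded_derive_neg_sin Hv). lra.
Qed.

(** On [[0, b]] the bound [(1 + 2 v) * diff2_majorant k] makes the series converge uniformly.
    Integrability of the weight comes out as part of the conclusion. *)
Lemma is_RInt_zeta_weight (zeta : C -> C) (p b : R) :
  is_riemann_zeta zeta -> Rabs p < PI -> 0 < b ->
  is_RInt (sinh_cosh_integrand (zeta_weight zeta) p) 0 b
    (Series (diff2 (fun x => RInt (fun v => im_pow (1 / 2) v x * sinh_sech p v) 0 b))).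
Proof.
  intros Hz Hp Hb.
  (* [filterlim_RInt] asks for uniform convergence on the whole line; clipping extends the functions
     constantly outside [[0, b]]. Agreement on the open interval suffices, and there [v > 0]. *)
  set (clip := fun v => Rmin b (Rmax 0 v)).
  assert (Hclip : forall v, 0 <= clip v <= b).
  { intros v. unfold clip. split; [|apply Rmin_l]. apply Rmin_glb; [lra | apply Rmax_l]. }
  assert (Hclip_id : forall v, 0 < v < b -> clip v = v).
  { intros v Hv. unfold clip. rewrite Rmax_right, Rmin_right; lra. }
  set (f := fun n v => sum_n (fun k => diff2 (im_pow (1 / 2) (clip v)) k * sinh_sech p (clip v)) n).
  set (g := fun v => Series (diff2 (im_pow (1 / 2) (clip v))) * sinh_sech p (clip v)).
  set (G := diff2 (fun x => RInt (fun v => im_pow (1 / 2) v x * sinh_sech p v) 0 b)).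
  destruct (filterlim_RInt (V := R_CompleteNormedModule) f 0 b eventually _ g (sum_n G)) as [I [HI Hg]].
  - intros n.
    apply is_RInt_ext with (fun v => sum_n (fun k => diff2 (im_pow (1 / 2) v) k * sinh_sech p v) n).
    + rewrite Rmin_left, Rmax_right by lra. intros v Hv. unfold f. now rewrite Hclip_id.
    + apply is_RInt_sum_n. intros k. apply is_RInt_diff2_im_pow.
  - apply (filterlim_locally (U := fct_UniformSpace R R_UniformSpace)). intros eps.
    destruct eps as [eps He].
    pose proof (proj1 (is_series_R _ _) (Series_correct _ ex_series_diff2_majorant)) as HM.
    pose proof (proj1 (filterlim_locally_R _ _ _ _) HM (eps / (1 + 2 * b))) as HM'.
    assert (Heb : 0 < eps / (1 + 2 * b)) by (apply Rdiv_lt_0_compat; lra).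
    generalize (HM' Heb). apply filter_imp. intros n Hn v.
    change (Rabs (f n v - g v) < eps). unfold f, g.
    specialize (Hclip v). set (u := clip v) in *.
    assert (Hs : sum_n (fun k => diff2 (im_pow (1 / 2) u) k * sinh_sech p u) n
      = sum_n (diff2 (im_pow (1 / 2) u)) n * sinh_sech p u :> R).
    { clear. induction n as [|n IH]; [now rewrite !sum_O|]. rewrite !sum_Sn_R, IH. ring. }
    rewrite Hs, <- Rmult_minus_distr_r, Rabs_mult, Rabs_minus_sym.
    pose proof (Series_tail (diff2 (im_pow (1 / 2) u)) (fun k => (1 + 2 * u) * diff2_majorant k) n
      (ex_series_scal_R _ _ ex_series_diff2_majorant)
      (fun k => diff2_im_pow_bound u k (proj1 Hclip))) as Ht.
    assert (Hs2 : sum_n (fun k => (1 + 2 * u) * diff2_majorant k) n = (1 + 2 * u) * sum_n diff2_majorant n :> R).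
    { clear. induction n as [|n IH]; [now rewrite !sum_O|]. rewrite !sum_Sn_R, IH. ring. }
    rewrite Series_scal_l, Hs2, <- Rmult_minus_distr_l in Ht.
    rewrite Rabs_minus_sym in Hn.
    assert (HK : Rabs (sinh_sech p u) <= 1).
    { eapply Rle_trans; [apply sinh_sech_bound; lra|]. rewrite <- exp_0. apply exp_le_compat. nra. }
    pose proof (Rle_abs (Series diff2_majorant - sum_n diff2_majorant n)) as Habs.
    pose proof (Rabs_pos (Series (diff2 (im_pow (1 / 2) u)) - sum_n (diff2 (im_pow (1 / 2) u)) n)) as H0.
    pose proof (Rabs_pos (sinh_sech p u)).
    assert (Hbu : (1 + 2 * u) * (Series diff2_majorant - sum_n diff2_majorant n) < eps).
    { apply Rle_lt_trans with ((1 + 2 * b) * Rabs (Series diff2_majorant - sum_n diff2_majorant n)).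
      - apply Rle_trans with ((1 + 2 * u) * Rabs (Series diff2_majorant - sum_n diff2_majorant n)).
        + apply Rmult_le_compat_l; lra.
        + apply Rmult_le_compat_r; [apply Rabs_pos | lra].
      - replace eps with ((1 + 2 * b) * (eps / (1 + 2 * b))) by (field; lra).
        apply Rmult_lt_compat_l; lra. }
    nra.
  - assert (HIG : Series G = I) by (apply is_series_unique, is_series_R; exact HI).
    rewrite HIG. apply is_RInt_ext with (2 := Hg).
    rewrite Rmin_left, Rmax_right by lra. intros v Hv. unfold g, sinh_cosh_integrand.
    rewrite Hclip_id by exact Hv. rewrite (zeta_weight_Series zeta) by (assumption || lra). reflexivity.
Qed.

(** Tannery's theorem with the upper bound [b] as parameter: the integral of term [k] is at most
    [diff2_majorant k] times that of [(1 + 2 v) exp (- d v)] over the half-line, which is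
    [1/d + 2/d^2]. *)
Lemma is_RInt_gen_zeta_weight (zeta : C -> C) (p : R) :
  is_riemann_zeta zeta -> Rabs p < PI ->
  is_RInt_gen (sinh_cosh_integrand (zeta_weight zeta) p) (at_point 0) (Rbar_locally p_infty)
    (Series (diff2 (mellin_kernel p))).
Proof.
  intros Hz Hp. apply is_RInt_gen_0_infty.
  { intros b Hb. eexists. now apply is_RInt_zeta_weight. }
  set (d := PI - Rabs p). assert (Hd : 0 < d) by (unfold d; lra).
  apply filterlim_ext_loc with
    (fun b => Series (fun k => diff2 (fun x => RInt (fun v => im_pow (1 / 2) v x * sinh_sech p v) 0 b) k)).
  { exists 0. intros b Hb. symmetry. apply is_RInt_unique. now apply is_RInt_zeta_weight. }
  apply (filterlim_Series_dom (Rbar_locally p_infty) _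
    (fun k b => diff2 (fun x => RInt (fun v => im_pow (1 / 2) v x * sinh_sech p v) 0 b) k) _
    (fun k => (1 / d + 2 / d ^ 2) * diff2_majorant k)).
  - apply ex_series_scal_R, ex_series_diff2_majorant.
  - exists 0. intros b Hb k.
    assert (HM : 0 <= diff2_majorant k).
    { pose proof (diff2_im_pow_bound 0 k (Rle_refl 0)) as H.
      pose proof (Rabs_pos (diff2 (im_pow (1 / 2) 0) k)). lra. }
    set (F := fun v => - ((1 + 2 * v) / d + 2 / d ^ 2) * exp (- d * v)).
    assert (HF : is_RInt (fun v => diff2_majorant k * ((1 + 2 * v) * exp (- d * v))) 0 b
      (diff2_majorant k * (F b - F 0))).
    { apply (is_RInt_scal (V := R_NormedModule) (fun v => (1 + 2 * v) * exp (- d * v))).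
      apply is_RInt_antiderivative.
      - intros v. unfold F. auto_derive; [trivial|]. field. lra.
      - intros v. auto_derive. trivial. }
    apply Rle_trans with (diff2_majorant k * (F b - F 0)).
    + apply (norm_RInt_le (V := R_NormedModule) _ _ 0 b _ _ (Rlt_le _ _ Hb))
        with (2 := is_RInt_diff2_im_pow p b k) (3 := HF).
      intros v Hv. change (Rabs (diff2 (im_pow (1 / 2) v) k * sinh_sech p v) <=
        diff2_majorant k * ((1 + 2 * v) * exp (- d * v))).
      rewrite Rabs_mult, <- Rmult_assoc, (Rmult_comm (diff2_majorant k)).
      apply Rmult_le_compat; try apply Rabs_pos.
      * apply diff2_im_pow_bound. lra.
      * apply sinh_sech_bound. lra.
    + rewrite Rmult_comm. apply Rmult_le_compat_r; [exact HM|].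
      unfold F. rewrite !Rmult_0_r, exp_0.
      assert (0 <= ((1 + 2 * b) / d + 2 / d ^ 2) * exp (- d * b)).
      { apply Rmult_le_pos; [|left; apply exp_pos].
        apply Rplus_le_le_0_compat; apply Rlt_le, Rdiv_lt_0_compat; try lra. now apply pow_lt. }
      replace ((1 + 0) / d) with (1 / d) by (f_equal; ring). lra.
  - intros k. apply filterlim_diff2; [apply Rbar_locally_filter|].
    intros x Hx. now apply filterlim_RInt_im_pow.
Qed.

(** * Analyticity and the value at [PI] *)

Definition sin_half (p : R) (j : nat) : R := sin ((INR j + 1 / 2) * p).

(** The factor is the characteristic polynomial of the recurrence [Hrec], so all inner terms cancel.
    The [1 + q] reflects that [sin_half] extended to index [-1] is [- sin (p / 2)]. *)
Lemma sum_geometric_sin_half (p q : R) (n : nat) :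
  (1 - 2 * q * cos p + q ^ 2) * sum_n (fun j => q ^ j * sin_half p j) n =
  sin (p / 2) * (1 + q) - q ^ S n * sin_half p (S n) + q ^ S (S n) * sin_half p n.
Proof.
  assert (H0 : sin_half p 0 = sin (p / 2)) by (unfold sin_half; f_equal; simpl; field).
  assert (Hrec : forall j, sin_half p (S (S j)) = 2 * cos p * sin_half p (S j) - sin_half p j).
  { intros j. unfold sin_half. rewrite !S_INR.
    set (u := (INR j + 1 + 1 / 2) * p).
    replace ((INR j + 1 + 1 + 1 / 2) * p) with (u + p) by (unfold u; ring).
    replace ((INR j + 1 / 2) * p) with (u - p) by (unfold u; ring).
    rewrite sin_plus, sin_minus. ring. }
  assert (H1 : sin_half p 1 = 2 * cos p * sin_half p 0 + sin_half p 0).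
  { unfold sin_half. simpl INR.
    replace ((1 + 1 / 2) * p) with ((0 + 1 / 2) * p + p) by field.
    assert (Hm : sin ((0 + 1 / 2) * p - p) = - sin ((0 + 1 / 2) * p)).
    { rewrite <- sin_neg. f_equal. field. }
    rewrite sin_minus in Hm. rewrite sin_plus. lra. }
  induction n as [|n IH].
  - rewrite sum_O, H1, H0. simpl. ring.
  - rewrite sum_Sn_R, Rmult_plus_distr_l, IH, Hrec. simpl. ring.
Qed.

Lemma geometric_cos_pos (p q : R) : Rabs q < 1 -> 0 < 1 - 2 * q * cos p + q ^ 2.
Proof.
  intros Hq. pose proof (COS_bound p) as Hc. apply Rabs_def2 in Hq.
  destruct (Rle_dec 0 q); nra.
Qed.

Lemma is_series_geometric_sin_half (p q : R) : Rabs q < 1 ->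
  is_series (fun j => q ^ j * sin_half p j) (sin (p / 2) * (1 + q) / (1 - 2 * q * cos p + q ^ 2)).
Proof.
  intros Hq. pose proof (geometric_cos_pos p q Hq) as HD.
  set (D := 1 - 2 * q * cos p + q ^ 2) in *.
  assert (Hl : filterlim (fun n => q ^ n) eventually (locally 0)) by now apply is_lim_seq_geom.
  assert (Hs : forall j, Rabs (sin_half p j) <= 1) by (intros j; apply Rabs_sin_le_1).
  assert (Hz : forall m g,
    filterlim (fun n => q ^ (m + n) * sin_half p (g n)) eventually (locally 0)).
  { intros m g. apply filterlim_locally_R; [apply eventually_filter|]. intros eps He.
    pose proof (filterlim_nat_comp _ (fun n => (m + n)%nat) _ ltac:(intros; cbv beta; lia) Hl) as H.
    generalize (proj1 (filterlim_locally_R _ _ _ _) H eps He). apply filter_imp. intros n Hn.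
    rewrite Rminus_0_r in *. rewrite Rabs_mult. specialize (Hs (g n)).
    pose proof (Rabs_pos (q ^ (m + n))). pose proof (Rabs_pos (sin_half p (g n))). nra. }
  apply is_series_R.
  replace (sin (p / 2) * (1 + q) / D) with (sin (p / 2) * (1 + q) / D + ((- / D) * 0 + / D * 0)) by (field; lra).
  apply filterlim_ext with (fun n => sin (p / 2) * (1 + q) / D +
    ((- / D) * (q ^ (1 + n) * sin_half p (S n)) + / D * (q ^ (2 + n) * sin_half p n))).
  - intros n. apply (Rmult_eq_reg_l D); [|lra]. unfold D at 5. rewrite sum_geometric_sin_half.
    simpl Nat.add. field. lra.
  - apply filterlim_plus_R; [apply eventually_filter | apply filterlim_const|].
    apply filterlim_plus_R; [apply eventually_filter | |];
      (apply filterlim_scal_R; [apply eventually_filter|]).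
    + apply Hz.
    + apply (Hz 2%nat (fun n => n)).
Qed.

Lemma is_series_mellin_kernel_lt1 (p x : R) : 0 < x < 1 ->
  is_series (fun j => (- x) ^ j * sin_half p j) (mellin_kernel p x).
Proof.
  intros Hx. unfold mellin_kernel.
  replace ((1 - x) * sin (p / 2) / (1 + 2 * x * cos p + x ^ 2))
    with (sin (p / 2) * (1 + - x) / (1 - 2 * (- x) * cos p + (- x) ^ 2)).
  - apply is_series_geometric_sin_half. apply Rabs_def1; lra.
  - f_equal; [ring | f_equal; ring].
Qed.

(** Inversion: [mellin_kernel p x = - / x * mellin_kernel p (/ x)], hence one more power than in the
    expansion for [x < 1]. *)
Lemma is_series_mellin_kernel_gt1 (p x : R) : 1 < x ->
  is_series (fun j => (- / x) ^ S j * sin_half p j) (mellin_kernel p x).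
Proof.
  intros Hx. unfold mellin_kernel.
  assert (Hi : 0 < / x < 1).
  { split; [apply Rinv_0_lt_compat; lra|]. rewrite <- Rinv_1. apply Rinv_lt_contravar; lra. }
  assert (Hq : Rabs (- / x) < 1) by (apply Rabs_def1; lra).
  pose proof (geometric_cos_pos p _ Hq) as HD.
  assert (HE : 1 - 2 * - / x * cos p + (- / x) ^ 2 = (1 + 2 * x * cos p + x ^ 2) / x ^ 2) by (field; lra).
  assert (HD2 : 0 < 1 + 2 * x * cos p + x ^ 2).
  { rewrite HE in HD. apply Rmult_lt_reg_r with (/ x ^ 2).
    - apply Rinv_0_lt_compat, pow_lt. lra.
    - rewrite Rmult_0_l. exact HD. }
  replace ((1 - x) * sin (p / 2) / (1 + 2 * x * cos p + x ^ 2))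
    with (- / x * (sin (p / 2) * (1 + - / x) / (1 - 2 * - / x * cos p + (- / x) ^ 2))).
  - apply is_series_ext_R with (fun j => - / x * ((- / x) ^ j * sin_half p j)).
    + intros j. simpl. ring.
    + apply is_series_scal_R, is_series_geometric_sin_half, Hq.
  - rewrite HE. field. lra.
Qed.

Definition inv_pow (j : nat) (x : R) : R := (- / x) ^ S j.

(** The mean value bound is [(j + 1) (2/5)^j], and [j + 1 <= 2^j] turns it into [(4/5)^j]. The [2/5]
    is the reciprocal of the smallest point [5/2]. *)
Lemma pow_S_increment (u w : R) (j : nat) : 0 <= w <= u -> u <= 2 / 5 ->
  0 <= u ^ S j - w ^ S j <= (4 / 5) ^ j * (u - w).
Proof.
  intros Hw Hu. split.
  { assert (w ^ S j <= u ^ S j) by (apply pow_incr; lra). lra. }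
  induction j as [|j IH]; [simpl; lra|].
  replace (u ^ S (S j) - w ^ S (S j)) with (u * (u ^ S j - w ^ S j) + w ^ S j * (u - w)) by (simpl; ring).
  assert (Hp : 0 < (4 / 5) ^ j) by (apply pow_lt; lra).
  assert (Hw' : w ^ S j <= 2 / 5 * (4 / 5) ^ j).
  { simpl. apply Rmult_le_compat; [lra | apply pow_le; lra | lra | apply pow_incr; lra]. }
  assert (H1 : u * (u ^ S j - w ^ S j) <= 2 / 5 * ((4 / 5) ^ j * (u - w))).
  { apply Rmult_le_compat; try lra.
    assert (w ^ S j <= u ^ S j) by (apply pow_incr; lra). lra. }
  assert (H2 : w ^ S j * (u - w) <= 2 / 5 * (4 / 5) ^ j * (u - w)) by (apply Rmult_le_compat_r; lra).
  replace ((4 / 5) ^ S j * (u - w)) with (2 / 5 * ((4 / 5) ^ j * (u - w)) + 2 / 5 * (4 / 5) ^ j * (u - w))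
    by (simpl; field).
  lra.
Qed.

Definition inv_telescope (k : nat) : R :=
  / (2 * INR (S k) + 1 / 2) - / (2 * INR (S (S k)) + 1 / 2).

Lemma ex_series_inv_telescope : ex_series inv_telescope.
Proof.
  apply (ex_series_telescope (fun k => / (2 * INR (S k) + 1 / 2)) 0).
  - intros k. rewrite (S_INR (S k)). pose proof (pos_INR (S k)).
    apply Rinv_le_contravar; lra.
  - intros k. pose proof (pos_INR (S k)). left. apply Rinv_0_lt_compat. lra.
Qed.

Lemma diff2_inv_pow_bound (j k : nat) :
  Rabs (diff2 (inv_pow j) (S k)) <= inv_telescope k * (4 / 5) ^ j.
Proof.
  rewrite Rmult_comm. apply (diff2_bound _ Rinv). intros x y Hx Hxy.
  assert (Hy : / y <= / x) by (apply Rinv_le_contravar; lra).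
  assert (Hx' : / x <= / (5 / 2)) by (apply Rinv_le_contravar; lra).
  assert (Hy' : 0 < / y) by (apply Rinv_0_lt_compat; lra).
  pose proof (pow_S_increment (/ x) (/ y) j ltac:(lra) ltac:(lra)) as H.
  unfold inv_pow.
  replace ((- / y) ^ S j - (- / x) ^ S j) with ((-1) ^ j * ((/ x) ^ S j - (/ y) ^ S j)).
  - rewrite Rabs_mult, pow_1_abs, Rmult_1_l, Rabs_pos_eq; lra.
  - replace (- / y) with (-1 * / y) by ring. replace (- / x) with (-1 * / x) by ring.
    rewrite !Rpow_mult_distr. simpl. ring.
Qed.

(** Coefficient of [sin_half p j] in the whole series. At index 0 the point [1/2] is expanded in
    powers of [x], [3/2] in powers of [1 / x], and the point 1 contributes nothing. *)
Definition sin_coef (j : nat) : R :=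
  - (- (1 / 2)) ^ j - (- / (3 / 2)) ^ S j + Series (fun k => diff2 (inv_pow j) (S k)).

Lemma sin_coef_bound (j : nat) : Rabs (sin_coef j) <= (2 + Series inv_telescope) * (4 / 5) ^ j.
Proof.
  assert (H1 : Rabs ((- (1 / 2)) ^ j) <= (4 / 5) ^ j).
  { rewrite <- RPow_abs. apply pow_incr. split; [apply Rabs_pos|]. apply Rabs_le; lra. }
  assert (H2 : Rabs ((- / (3 / 2)) ^ S j) <= (4 / 5) ^ j).
  { simpl. rewrite Rabs_mult, <- RPow_abs. rewrite <- (Rmult_1_l ((4 / 5) ^ j)).
    apply Rmult_le_compat; [apply Rabs_pos | apply pow_le, Rabs_pos | apply Rabs_le; lra|].
    apply pow_incr. split; [apply Rabs_pos|]. apply Rabs_le; lra. }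
  assert (H3 : Rabs (Series (fun k => diff2 (inv_pow j) (S k))) <= Series inv_telescope * (4 / 5) ^ j).
  { rewrite <- Series_scal_r.
    pose proof (fun k => diff2_inv_pow_bound j k) as Hb.
    assert (He : ex_series (fun k => inv_telescope k * (4 / 5) ^ j)) by apply ex_series_scal_r, ex_series_inv_telescope.
    eapply Rle_trans; [apply Series_Rabs|].
    - apply ex_series_dom with (1 := He). intros k. rewrite Rabs_Rabsolu. apply Hb.
    - apply Series_le; [|exact He]. intros k. split; [apply Rabs_pos | apply Hb]. }
  unfold sin_coef.
  pose proof (Rabs_triang (- (- (1 / 2)) ^ j - (- / (3 / 2)) ^ S j) (Series (fun k => diff2 (inv_pow j) (S k)))).
  pose proof (Rabs_triang (- (- (1 / 2)) ^ j) (- (- / (3 / 2)) ^ S j)) as H5.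
  rewrite !Rabs_Ropp in H5. unfold Rminus in *. lra.
Qed.

Lemma ex_series_45 : ex_series (fun j => (4 / 5) ^ j).
Proof. apply ex_series_geom. rewrite Rabs_pos_eq; lra. Qed.

Lemma is_series_diff2_mellin_kernel (p : R) (k : nat) :
  is_series (fun j => diff2 (inv_pow j) (S k) * sin_half p j) (diff2 (mellin_kernel p) (S k)).
Proof.
  (* [is_series_diff2] requires an expansion at every [x > 0], whereas the one in [1 / x] holds for
     [x > 1]; below that both sides are set to 0. *)
  set (G := fun x => if Rlt_dec 1 x then mellin_kernel p x else 0).
  set (g := fun j x => if Rlt_dec 1 x then inv_pow j x * sin_half p j else 0).
  pose proof (pos_INR k) as Hk. pose proof (S_INR k) as HSk.
  assert (HG : diff2 (mellin_kernel p) (S k) = diff2 G (S k)).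
  { unfold diff2, G. repeat (destruct Rlt_dec; [|exfalso; lra]). reflexivity. }
  rewrite HG. apply is_series_ext_R with (fun j => diff2 (g j) (S k)).
  - intros j. unfold diff2, g. repeat (destruct Rlt_dec; [|exfalso; lra]). ring.
  - apply is_series_diff2. intros x _. unfold g, G. destruct (Rlt_dec 1 x) as [H|H].
    + now apply is_series_mellin_kernel_gt1.
    + apply is_series_ext_R with (2 := is_series_single 0). intros n. ring.
Qed.

(** The numerator is 0, so the value is 0 even at [p = PI], where the denominator vanishes too. *)
Lemma mellin_kernel_1 (p : R) : mellin_kernel p 1 = 0.
Proof. unfold mellin_kernel, Rdiv. ring. Qed.

(** Valid for every real [p], including [PI] and beyond: the majorant [inv_telescope k * (4/5)^j] of
    the double series is independent of [p]. *)
Lemma Series_diff2_mellin_kernel (p : R) :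
  Series (diff2 (mellin_kernel p)) = Series (fun j => sin_coef j * sin_half p j).
Proof.
  assert (Hb : forall k j, Rabs (diff2 (inv_pow j) (S k) * sin_half p j) <= inv_telescope k * (4 / 5) ^ j).
  { intros k j. rewrite Rabs_mult. pose proof (diff2_inv_pow_bound j k).
    pose proof (Rabs_sin_le_1 ((INR j + 1 / 2) * p)) as Hs. fold (sin_half p j) in Hs.
    pose proof (Rabs_pos (diff2 (inv_pow j) (S k))). pose proof (Rabs_pos (sin_half p j)). nra. }
  pose proof (is_series_swap (fun k j => diff2 (inv_pow j) (S k) * sin_half p j) _ _
    ex_series_inv_telescope ex_series_45 Hb) as Hswap.
  rewrite (Series_ext _ (fun k => diff2 (mellin_kernel p) (S k))) in Hswap.
  2: { intros k. apply is_series_unique, is_series_diff2_mellin_kernel. }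
  assert (Hex : ex_series (diff2 (mellin_kernel p))).
  { apply ex_series_incr_1.
    apply ex_series_dom with (fun k => inv_telescope k * Series (fun j => (4 / 5) ^ j)).
    - apply ex_series_scal_r, ex_series_inv_telescope.
    - intros k. rewrite <- (is_series_unique _ _ (is_series_diff2_mellin_kernel p k)).
      rewrite <- Series_scal_l.
      assert (He : ex_series (fun j => inv_telescope k * (4 / 5) ^ j)) by apply ex_series_scal_R, ex_series_45.
      eapply Rle_trans; [apply Series_Rabs|].
      + apply ex_series_dom with (1 := He). intros j. rewrite Rabs_Rabsolu. apply Hb.
      + apply Series_le; [|exact He]. intros j. split; [apply Rabs_pos | apply Hb]. }
  rewrite (Series_incr_1 _ Hex). symmetry. apply is_series_unique.
  assert (H0 : diff2 (mellin_kernel p) 0 = (-1) * mellin_kernel p (1 / 2) + (-1) * mellin_kernel p (3 / 2)).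
  { unfold diff2. simpl INR. replace (2 * 0 + 1) with 1 by ring.
    replace (2 * 0 + 1 / 2) with (1 / 2) by ring. replace (2 * 0 + 3 / 2) with (3 / 2) by ring.
    rewrite mellin_kernel_1. ring. }
  rewrite H0.
  apply is_series_ext_R with (fun j => ((-1) * ((- (1 / 2)) ^ j * sin_half p j)
    + (-1) * ((- / (3 / 2)) ^ S j * sin_half p j))
    + Series (fun k => diff2 (inv_pow j) (S k) * sin_half p j)).
  - intros j. rewrite Series_scal_r. unfold sin_coef. ring.
  - apply is_series_plus_R; [apply is_series_plus_R; apply is_series_scal_R|exact Hswap].
    + apply is_series_mellin_kernel_lt1. lra.
    + apply is_series_mellin_kernel_gt1. lra.
Qed.

(* Taylor coefficients of [h |-> s cos h + c sin h]. *)
Definition trig_coef (s c : R) (i : nat) : R :=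
  if Nat.even i then s * cos_n (Nat.div2 i) else c * sin_n (Nat.div2 i).

Lemma is_series_trig_coef (s c h : R) :
  is_series (fun i => trig_coef s c i * h ^ i) (s * cos h + c * sin h).
Proof.
  apply (proj1 (is_pseries_R _ _ _)).
  assert (Hc : is_pseries cos_n (h ^ 2) (cos h)).
  { apply (proj2 (is_pseries_R _ _ _)). unfold cos. destruct (exist_cos (Rsqr h)) as [l Hl].
    apply is_series_Reals. unfold cos_in in Hl. rewrite Rsqr_pow2 in Hl. exact Hl. }
  assert (Hs : exists l, sin h = h * l /\ is_pseries sin_n (h ^ 2) l).
  { unfold sin. destruct (exist_sin (Rsqr h)) as [l Hl]. exists l. split; [reflexivity|].
    apply (proj2 (is_pseries_R _ _ _)). apply is_series_Reals. unfold sin_in in Hl. rewrite Rsqr_pow2 in Hl. exact Hl. }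
  destruct Hs as [l [-> Hl]].
  replace (s * cos h + c * (h * l)) with (s * cos h + h * (c * l)) by ring.
  apply is_pseries_odd_even; apply (proj2 (is_pseries_R _ _ _)).
  - apply is_series_ext_R with (fun n => s * (cos_n n * (h ^ 2) ^ n)).
    + intros n. unfold trig_coef. rewrite Nat.even_even, Nat.div2_double. ring.
    + apply is_series_scal_R, (proj1 (is_pseries_R _ _ _)), Hc.
  - apply is_series_ext_R with (fun n => c * (sin_n n * (h ^ 2) ^ n)).
    + intros n. unfold trig_coef. rewrite Nat.even_odd.
      replace (2 * n + 1)%nat with (S (2 * n)) by lia. rewrite Nat.div2_succ_double. ring.
    + apply is_series_scal_R, (proj1 (is_pseries_R _ _ _)), Hl.
Qed.

Lemma trig_coef_bound (s c : R) (i : nat) : Rabs s <= 1 -> Rabs c <= 1 ->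
  Rabs (trig_coef s c i) <= / INR (Factorial.fact i).
Proof.
  intros Hs Hc. unfold trig_coef.
  assert (Hgen : forall x n m, Rabs x <= 1 ->
    Rabs (x * ((-1) ^ n / INR (Factorial.fact m))) <= / INR (Factorial.fact m)).
  { intros x n m Hx. assert (0 < / INR (Factorial.fact m)) by apply Rinv_0_lt_compat, INR_fact_lt_0.
    unfold Rdiv. rewrite !Rabs_mult, pow_1_abs, (Rabs_pos_eq (/ _)) by lra.
    pose proof (Rabs_pos x). nra. }
  destruct (Nat.Even_or_Odd i) as [[n ->]|[n ->]].
  - rewrite Nat.even_even, Nat.div2_double. unfold cos_n. now apply Hgen.
  - rewrite Nat.even_odd. replace (2 * n + 1)%nat with (S (2 * n)) by lia.
    rewrite Nat.div2_succ_double. unfold sin_n. replace (2 * n + 1)%nat with (S (2 * n)) by lia. now apply Hgen.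
Qed.

(** Expanding [sin ((j + 1/2) p)] to radius [r] costs a factor [exp (2 r (j + 1/2))], which the
    decay [(4/5)^j] of [sin_coef] absorbs for small [r]. *)
Lemma analytic_at_Series_mellin_kernel (p : R) :
  @analytic_at R_AbsRing (fun p => Series (diff2 (mellin_kernel p))) p.
Proof.
  apply (analytic_at_ext_loc (fun p => Series (fun j => sin_coef j * sin_half p j)) _ _ 1 Rlt_0_1).
  { intros y _. symmetry. apply Series_diff2_mellin_kernel. }
  set (C := 2 + Series inv_telescope).
  (* Chosen so that [exp (2 r) = 9/8]: the resulting ratio [4/5 * 9/8 = 9/10] is below 1. *)
  set (r := ln (9 / 8) / 2).
  assert (Hr : 0 < r).
  { unfold r. assert (0 < ln (9 / 8)); [|lra]. rewrite <- ln_1. apply ln_increasing; lra. }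
  assert (Hr2 : exp (2 * r) = 9 / 8).
  { unfold r. replace (2 * (ln (9 / 8) / 2)) with (ln (9 / 8)) by field. apply exp_ln. lra. }
  set (B := fun j => INR j + 1 / 2).
  apply (analytic_at_Series _ (fun j i => sin_coef j * (trig_coef (sin (B j * p)) (cos (B j * p)) i * B j ^ i))
    (fun j => C * exp r * (9 / 10) ^ j) p r Hr).
  - apply ex_series_scal_R, ex_series_geom. rewrite Rabs_pos_eq; lra.
  - intros j i. assert (HB : 0 <= B j) by (unfold B; pose proof (pos_INR j); lra).
    assert (HBi : 0 <= B j ^ i) by now apply pow_le.
    assert (Hri : 0 <= r ^ i) by (apply pow_le; lra).
    pose proof (trig_coef_bound (sin (B j * p)) (cos (B j * p)) i (Rabs_sin_le_1 _) (Rabs_cos_le_1 _)) as Ht.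
    pose proof (sin_coef_bound j) as Hc. fold C in Hc.
    pose proof (pow_fact_le_exp_geom r (B j) i (Rlt_le _ _ Hr) HB) as He.
    assert (Hexp : exp (2 * r * B j) = exp r * (9 / 8) ^ j).
    { unfold B. rewrite <- Hr2. replace (2 * r * (INR j + 1 / 2)) with (r + 2 * r * INR j) by field.
      rewrite exp_plus. f_equal. clear. induction j as [|j IH].
      - simpl. rewrite Rmult_0_r. apply exp_0.
      - rewrite S_INR, Rmult_plus_distr_l, exp_plus, IH, Rmult_1_r. simpl. ring. }
    rewrite Hexp in He.
    rewrite !Rabs_mult, (Rabs_pos_eq (B j ^ i)) by exact HBi.
    apply Rle_trans with (C * (4 / 5) ^ j * (/ 2 ^ i * (exp r * (9 / 8) ^ j))).
    + rewrite Rmult_assoc. apply Rmult_le_compat; try assumption.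
      * apply Rabs_pos.
      * apply Rmult_le_pos; [apply Rmult_le_pos; [apply Rabs_pos | exact HBi] | exact Hri].
      * eapply Rle_trans; [|exact He]. rewrite Rmult_comm. apply Rmult_le_compat_l; [exact Hri|].
        apply Rmult_le_compat_r; assumption.
    + right. replace (9 / 10) with (4 / 5 * (9 / 8)) by field. rewrite Rpow_mult_distr. ring.
  - intros j h _.
    apply is_series_ext_R with
      (fun i => sin_coef j * (trig_coef (sin (B j * p)) (cos (B j * p)) i * (B j * h) ^ i)).
    { intros i. rewrite Rpow_mult_distr. ring. }
    apply is_series_scal_R.
    replace (sin_half (p + h) j) with (sin (B j * p) * cos (B j * h) + cos (B j * p) * sin (B j * h)).
    + apply is_series_trig_coef.
    + unfold sin_half. fold (B j). rewrite <- sin_plus. f_equal. ring.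
Qed.

(** * The rational series at [p = PI] *)

Definition alt_harmonic (k : nat) : R := / (2 * INR k + 1) - / (2 * INR k + 2).

(** The difference between [ln (1 + x)] and its Taylor polynomial of degree [2n + 2] has derivative
    [x^(2n+2) / (1 + x) <= x^(2n+2)], compared with a primitive of [x^(2n+2)] on [[0, 1]]. *)
Lemma alt_harmonic_ln2 (n : nat) :
  Rabs (ln 2 - sum_n alt_harmonic n) <= / (2 * INR n + 3).
Proof.
  set (S1 := fun n x =>
    sum_n (fun k => x ^ (2 * k + 1) / (2 * INR k + 1) - x ^ (2 * k + 2) / (2 * INR k + 2)) n : R).
  assert (Hd : forall n x, 0 <= x -> is_derive (S1 n) x (/ (1 + x) - x ^ (2 * n + 2) / (1 + x))).
  { intros m x Hx.
    assert (Hk : forall k, is_derive (fun x => x ^ (2 * k + 1) / (2 * INR k + 1)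
      - x ^ (2 * k + 2) / (2 * INR k + 2)) x
      (x ^ (2 * k) - x ^ (2 * k + 1))).
    { intros k. pose proof (pos_INR k). auto_derive; [trivial|].
      replace (k + (k + 0) + 1)%nat with (S (2 * k)) by lia.
      replace (k + (k + 0) + 2)%nat with (S (S (2 * k))) by lia.
      replace (2 * k + 1)%nat with (S (2 * k)) by lia.
      simpl Init.Nat.pred. rewrite !S_INR, mult_INR. simpl (INR 2).
      change (k + (k + 0))%nat with (2 * k)%nat. rewrite <- !tech_pow_Rmult. field. lra. }
    induction m as [|m IH].
    - apply (is_derive_ext (fun x => x ^ (2 * 0 + 1) / (2 * INR 0 + 1) - x ^ (2 * 0 + 2) / (2 * INR 0 + 2))).
      { intros t. unfold S1. now rewrite sum_O. }
      replace (/ (1 + x) - x ^ (2 * 0 + 2) / (1 + x)) with (x ^ (2 * 0) - x ^ (2 * 0 + 1)) by (simpl; field; lra).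
      apply Hk.
    - apply (is_derive_ext (fun x => S1 m x + (x ^ (2 * S m + 1) / (2 * INR (S m) + 1)
        - x ^ (2 * S m + 2) / (2 * INR (S m) + 2)))).
      { intros t. unfold S1. now rewrite sum_Sn_R. }
      replace (/ (1 + x) - x ^ (2 * S m + 2) / (1 + x))
        with ((/ (1 + x) - x ^ (2 * m + 2) / (1 + x)) + (x ^ (2 * S m) - x ^ (2 * S m + 1))).
      + apply (is_derive_plus (V := R_NormedModule) (S1 m)); [exact IH | apply Hk].
      + replace (2 * S m + 2)%nat with (S (S (2 * m + 2))) by lia.
        replace (2 * S m + 1)%nat with (S (2 * m + 2)) by lia.
        replace (2 * S m)%nat with (2 * m + 2)%nat by lia. simpl pow. field. lra. }
  pose proof (pos_INR n) as Hn.
  pose proof (Rabs_increment_le (fun x => ln (1 + x) - S1 n x) (fun x => - (x ^ (2 * n + 3) / (2 * INR n + 3)))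
    (fun x => x ^ (2 * n + 2) / (1 + x)) (fun x => - x ^ (2 * n + 2)) 0 1 Rle_0_1) as H.
  cbv beta in H.
  assert (E1 : S1 n 1 = sum_n alt_harmonic n).
  { unfold S1. apply sum_n_ext. intros k. unfold alt_harmonic. rewrite !pow1. unfold Rdiv.
    now rewrite !Rmult_1_l. }
  assert (E0 : S1 n 0 = 0).
  { assert (Hz : forall m, S1 m 0 = 0 :> R); [|apply Hz]. unfold S1. clear.
    intros m. induction m as [|m IH].
    - rewrite sum_O. simpl. field.
    - rewrite sum_Sn_R, IH, !pow_i by lia. unfold Rdiv. ring. }
  rewrite E1, E0, pow1, pow_i in H by lia.
  replace (1 + 0) with 1 in H by ring. rewrite ln_1 in H.
  replace (ln (1 + 1) - sum_n alt_harmonic n - (0 - 0)) with (ln 2 - sum_n alt_harmonic n) in H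
    by (replace (1 + 1) with 2 by ring; ring).
  replace (- (0 / (2 * INR n + 3)) - - (1 / (2 * INR n + 3))) with (/ (2 * INR n + 3)) in H by (field; lra).
  apply H.
  - intros x Hx.
    replace (x ^ (2 * n + 2) / (1 + x)) with (/ (1 + x) - (/ (1 + x) - x ^ (2 * n + 2) / (1 + x))) by ring.
    apply (is_derive_minus (V := R_NormedModule) (fun x => ln (1 + x)) (S1 n)); [|apply Hd; lra].
    auto_derive; [lra|]. field. lra.
  - intros x Hx. auto_derive; [trivial|].
    replace (n + (n + 0) + 3)%nat with (S (2 * n + 2)) by lia. simpl Init.Nat.pred.
    rewrite S_INR, plus_INR, mult_INR. simpl (INR 2).
    replace (2 * n + 2)%nat with (n + (n + 0) + 2)%nat by lia. field. lra.
  - intros x Hx. rewrite Ropp_involutive.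
    assert (Hp : 0 <= x ^ (2 * n + 2)) by (apply pow_le; lra).
    assert (Hi : 0 < / (1 + x) <= 1).
    { split; [apply Rinv_0_lt_compat; lra|]. rewrite <- Rinv_1. apply Rinv_le_contravar; lra. }
    unfold Rdiv. rewrite Rabs_pos_eq by (apply Rmult_le_pos; lra). nra.
Qed.

Lemma filterlim_alt_harmonic : filterlim (fun n => sum_n alt_harmonic n : R) eventually (locally (ln 2)).
Proof.
  apply filterlim_locally_R; [apply eventually_filter|]. intros eps He.
  generalize (proj1 (filterlim_locally_R _ _ _ _) filterlim_inv_INR_S eps He).
  apply filter_imp. intros n Hn. rewrite Rminus_0_r in Hn.
  rewrite Rabs_minus_sym. eapply Rle_lt_trans; [apply alt_harmonic_ln2|].
  eapply Rle_lt_trans; [|eapply Rle_lt_trans; [apply Rle_abs | exact Hn]].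
  rewrite S_INR. pose proof (pos_INR n). apply Rinv_le_contravar; lra.
Qed.

Lemma mellin_kernel_PI (x : R) : x <> 1 -> mellin_kernel PI x = / (1 - x).
Proof.
  intros Hx. unfold mellin_kernel. rewrite cos_PI, sin_PI2.
  replace (1 + 2 * x * -1 + x ^ 2) with ((1 - x) * (1 - x)) by ring. field. lra.
Qed.

(** Term 0 is [-2 + 2 = 0], and term [k >= 1] is [2/(4k-1) + 2/(4k+1) - 1/k]. Twice the alternating
    sum up to [4n + 2] supplies the odd reciprocals, the second alternating sum corrects the even
    ones up to [1 / (2 (n + 1))], and the [-2] removes twice the reciprocal of 1, which does not
    occur. *)
Lemma Series_mellin_kernel_PI : Series (diff2 (mellin_kernel PI)) = 3 * ln 2 - 2.
Proof.
  apply is_series_unique, is_series_R.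
  assert (Hpart : forall n, sum_n (diff2 (mellin_kernel PI)) n =
    2 * sum_n alt_harmonic (2 * n) + sum_n alt_harmonic n + (1 / 2 * / INR (S n) + -2) :> R).
  { intros n. induction n as [|n IH].
    - simpl Nat.mul. rewrite !sum_O. unfold diff2, alt_harmonic. simpl INR.
      replace (2 * 0 + 1) with 1 by ring. rewrite mellin_kernel_1, !mellin_kernel_PI by lra. field.
    - replace (2 * S n)%nat with (S (S (2 * n))) by lia. rewrite !sum_Sn_R, IH.
      unfold diff2, alt_harmonic. pose proof (pos_INR n) as Hn.
      rewrite !mellin_kernel_PI by (rewrite S_INR; lra).
      rewrite !S_INR, mult_INR. simpl (INR 2). field. repeat split; lra. }
  replace (3 * ln 2 - 2) with (2 * ln 2 + ln 2 + (1 / 2 * 0 + -2)) by ring.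
  apply filterlim_ext with (fun n =>
    2 * sum_n alt_harmonic (2 * n) + sum_n alt_harmonic n + (1 / 2 * / INR (S n) + -2)).
  { intros n. symmetry. apply Hpart. }
  repeat apply filterlim_plus_R; try apply eventually_filter; try apply filterlim_const;
    try (apply filterlim_scal_R; [apply eventually_filter|]).
  - apply (filterlim_nat_comp (fun n => sum_n alt_harmonic n : R) (fun n => (2 * n)%nat)); [intros; lia|].
    apply filterlim_alt_harmonic.
  - apply filterlim_alt_harmonic.
  - apply filterlim_inv_INR_S.
Qed.

(* The convergence of the integrals inside the limit is part of the first
   conjunct. *)
Theorem mainTheorem11 (zeta : C -> C) (hzeta : is_riemann_zeta zeta) :
  is_continued_tanh_integral (zeta_weight zeta) (3 * ln 2 - 2) /\
  filterlim
    (fun phi : R =>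
       RInt_gen (sinh_cosh_integrand (zeta_weight zeta) phi)
         (at_point 0) (Rbar_locally p_infty))
    (at_left PI) (locally (3 * ln 2 - 2)).
Proof.
  split.
  - exists (fun p => Series (diff2 (mellin_kernel p))). split; [|split].
    + intros p Hp. now apply is_RInt_gen_zeta_weight.
    + intros p _. apply analytic_at_Series_mellin_kernel.
    + apply Series_mellin_kernel_PI.
  - rewrite <- Series_mellin_kernel_PI. pose proof PI_RGT_0 as Hpi.
    apply filterlim_ext_loc with (fun p => Series (diff2 (mellin_kernel p))).
    (* Within distance [PI] on the left of [PI], [0 < p < PI], so the integral converges and has the
       value just computed. *)
    + exists (mkposreal PI Hpi). intros p Hp Hlt. change (Rabs (p - PI) < PI) in Hp.
      apply Rabs_def2 in Hp. symmetry.
      apply (is_RInt_gen_unique (V := R_CompleteNormedModule)), is_RInt_gen_zeta_weight;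
        [exact hzeta | apply Rabs_def1; lra].
    + eapply filterlim_filter_le_1;
        [apply filter_le_within | apply analytic_at_continuous, analytic_at_Series_mellin_kernel].
Qed.
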